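(* Let $G$ be a group and $\mathcal{H}$ be a Hilbert space. The following are equivalent: (A) $G$ is amenable; (B) there exist a $B(\mathcal{H})$-valued positive semi-definite left-sesquilinear form $\langle\cdot,\cdot\rangle$ on $\ell^\infty(G,B(\mathcal{H}))$ and a real number $\kappa>0$ such that (a) $\langle\mathbf{1},\mathbf{1}\rangle\neq 0$, where $\mathbf{1}\in\ell^\infty(G,B(\mathcal{H}))$ is the constant map equal to $\mathrm{Id}_{\mathcal{H}}$; (b) $\|\langle\varphi,\varphi\rangle\|\leq\kappa\|\varphi\|^2$ for all $\varphi\in\ell^\infty(G,B(\mathcal{H}))$; (c) the map $x\mapsto\langle\lambda(x)\varphi,\varphi\rangle$ from $G$ to $B(\mathcal{H})$ is positive definite for all $\varphi\in\ell^\infty(G,B(\mathcal{H}))$; (C) there exists a state $\tau$ on $\ell^\infty(G)$ such that for every uniformly bounded map $\varphi\colon G\to B(\mathcal{H})$ there exists a positive definite map $\psi\colon G\to B(\mathcal{H})$ such that $$\Phi(\varphi(x)^*\psi(x))=\tau_y\,\Phi(\varphi(x)^*\varphi(xy)\varphi(y)^* )$$ for all $x\in G$ and every normal linear functional $\Phi\in B(\mathcal{H})_*$.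
   Context: Groups are discrete; amenable means amenable as a discrete group. $B(\mathcal{H})$ is the algebra of bounded operators with the operator norm. A map $\varphi\colon G\to B(\mathcal{H})$ is uniformly bounded if $\|\varphi\|:=\sup_{x\in G}\|\varphi(x)\|<\infty$; $\ell^\infty(G,B(\mathcal{H}))$ is the complex vector space of such maps. $\lambda$ is the left regular representation: $(\lambda(x)\varphi)(y)=\varphi(x^{-1}y)$. A left-sesquilinear form is one that is conjugate-linear in the first variable and linear in the second (no module-linearity is required); a $B(\mathcal{H})$-valued form is positive semi-definite if $\langle v,v\rangle\geq 0$ in $B(\mathcal{H})$ for all $v$. A map $\psi\colon G\to B(\mathcal{H})$ is positive definite if for every finite set $\{x_1,\dots,x_n\}\subset G$ the operator matrix $(\psi(x_i^{-1}x_j))_{ij}$ is positive. $\ell^\infty(G)$ is the algebra of bounded complex functions on $G$; $\tau_y f(y)$ denotes $\tau$ applied to the bounded function $y\mapsto f(y)$. $B(\mathcal{H})_*$ is the predual, i.e. the space of normal (ultraweakly continuous) linear functionals on $B(\mathcal{H})$.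
   Formalization: The Hilbert space is assumed to be nonzero: for the zero Hilbert space, condition (B)(a) always fails while (C) always holds, so the stated equivalence is false there. *)

(* Defs.v *)
From HB Require Import structures.
From mathcomp Require Import all_boot all_order all_algebra.
From mathcomp Require Import complex.
From mathcomp Require Import boolp classical_sets functions reals topology.
From mathcomp Require Import normedtype sequences.

Set Implicit Arguments.
Unset Strict Implicit.
Unset Printing Implicit Defensive.

Import Order.TTheory GRing.Theory Num.Theory.
Import numFieldNormedType.Exports.

Local Open Scope classical_set_scope.
Local Open Scope complex_scope.
Local Open Scope ring_scope.

(* Norms over R[i] are R[i]-valued (with values in the nonnegative reals),
   whence the complex.Re under sup. `sup` is 0 on unbounded sets, so sup_norm is
   the intended value only for functions satisfying bounded_on. *)
Section sup_norm.
Variables (R : realType) (T : Type) (V : normedModType R[i]) (D : set T).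
Implicit Types f g : T -> V.

Definition bounded_on f := exists M : R, forall x, D x -> `|f x| <= M%:C.

Definition sup_norm f : R := sup [set complex.Re `|f x| | x in D].

Lemma Re_normE (v : V) : (complex.Re `|v|)%:C = `|v|.
Proof. by apply: RRe_real; rewrite normr_real. Qed.

Let Re_normC (a : R[i]) : (complex.Re `|a|)%:C = `|a|.
Proof. by apply: RRe_real; rewrite normr_real. Qed.

Lemma sup_norm_ub f x : bounded_on f -> D x -> `|f x| <= (sup_norm f)%:C.
Proof.
move=> [M fM] Dx; rewrite -Re_normE lecR; apply: ub_le_sup; last by exists x.
by exists M => _ [y Dy <-]; rewrite -lecR Re_normE; exact: fM.
Qed.

Lemma sup_norm_le f (M : R) : 0 <= M -> (forall x, D x -> `|f x| <= M%:C) ->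
  sup_norm f <= M.
Proof.
move=> M0 fM; rewrite /sup_norm; have [->|/set0P ne] := eqVneq [set complex.Re `|f x| | x in D] set0.
  by rewrite sup0.
apply: ge_sup => // _ [y Dy <-]; rewrite -lecR Re_normE; exact: fM.
Qed.

Lemma sup_norm_ge0 f : 0 <= sup_norm f.
Proof.
rewrite /sup_norm; have [[[_ [y Dy _]] ub]|/sup_out->//] :=
  pselect (has_sup [set complex.Re `|f x| | x in D]).
apply: le_trans (ub_le_sup ub _); last by exists y.
by rewrite -lecR Re_normE; exact: normr_ge0.
Qed.

Lemma bounded_on0 : bounded_on (0 : T -> V).
Proof. by exists 0 => x _; rewrite normr0. Qed.

Lemma bounded_onP (a : R[i]) f g :
  bounded_on f -> bounded_on g -> bounded_on (a *: f + g).
Proof.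
move=> [M fM] [N gN]; exists (complex.Re `|a| * M + N) => x Dx.
rewrite (_ : _%:C = `|a| * M%:C + N%:C); last first.
  by rewrite -[in RHS](Re_normC a) -rmorphM -rmorphD.
apply: le_trans (ler_normD _ _) _; apply: lerD; last exact: gN.
by rewrite normrZ ler_wpM2l//; exact: fM.
Qed.

Lemma sup_normD f g : bounded_on f -> bounded_on g ->
  sup_norm (f + g) <= sup_norm f + sup_norm g.
Proof.
move=> bf bg; apply: sup_norm_le; first by rewrite addr_ge0 ?sup_norm_ge0.
move=> x Dx; rewrite rmorphD; apply: le_trans (ler_normD _ _) _.
by apply: lerD; exact: sup_norm_ub.
Qed.

Lemma sup_normZ (a : R[i]) f : bounded_on f ->
  (sup_norm (a *: f))%:C = `|a| * (sup_norm f)%:C.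
Proof.
have le b g : bounded_on g -> (sup_norm (b *: g))%:C <= `|b| * (sup_norm g)%:C.
  move=> bg; rewrite -(Re_normC b) -rmorphM lecR.
  have b0 : 0 <= complex.Re `|b| by rewrite -lecR Re_normC; exact: normr_ge0.
  apply: sup_norm_le => [|x Dx]; first by rewrite mulr_ge0 ?sup_norm_ge0.
  rewrite (_ : _%:C = `|b| * (sup_norm g)%:C); last first.
    by rewrite -[in RHS](Re_normC b) -rmorphM.
  rewrite normrZ ler_wpM2l//.
  exact: sup_norm_ub.
move=> bf; apply/eqP; rewrite eq_le le//=.
have [->|a0] := eqVneq a 0; first by rewrite normr0 mul0r lecR sup_norm_ge0.
rewrite -ler_pdivlMl ?normr_gt0// -normfV.
apply: le_trans (le _ _ _); first by rewrite scalerK.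
by have := bounded_onP a bf bounded_on0; rewrite addr0.
Qed.

Lemma sup_norm_eq0 f : bounded_on f -> (sup_norm f)%:C = 0 ->
  forall x, D x -> f x = 0.
Proof.
move=> bf f0 x Dx; apply/eqP; rewrite -normr_le0 -f0; exact: sup_norm_ub.
Qed.

End sup_norm.

Section linfty.
Variables (R : realType) (G : Type) (V : normedModType R[i]).

Definition linfty_pred : {pred G -> V} := mem [set f | bounded_on setT f].

Record linfty := Linfty { linfty_val :> G -> V ;
                          linfty_valP : linfty_val \in linfty_pred }.

HB.instance Definition _ := [isSub for linfty_val].
HB.instance Definition _ := [Choice of linfty by <:].

Lemma linfty_submod_closed : submod_closed linfty_pred.
Proof.
split; first by rewrite inE; exact: bounded_on0.
by move=> a f g; rewrite !inE; exact: bounded_onP.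
Qed.

HB.instance Definition _ :=
  GRing.isSubmodClosed.Build _ _ linfty_pred linfty_submod_closed.
HB.instance Definition _ := [SubChoice_isSubLmodule of linfty by <:].

Lemma linfty_bounded (f : linfty) : bounded_on setT f.
Proof. by case: f => f /=; rewrite inE. Qed.

Definition linfty_norm (f : linfty) : R[i] := (sup_norm setT f)%:C.

Lemma linfty_normD f g : linfty_norm (f + g) <= linfty_norm f + linfty_norm g.
Proof. by rewrite -rmorphD lecR; apply: sup_normD; exact: linfty_bounded. Qed.

Lemma linfty_normZ (a : R[i]) f : linfty_norm (a *: f) = `|a| * linfty_norm f.
Proof. by apply: sup_normZ; exact: linfty_bounded. Qed.

Lemma linfty_norm0_eq0 f : linfty_norm f = 0 -> f = 0.
Proof.
move=> f0; apply/val_inj/funext => x.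
exact: (sup_norm_eq0 (linfty_bounded f) f0).
Qed.

HB.instance Definition _ := Lmodule_isNormed.Build R[i] linfty
  linfty_normD linfty_normZ linfty_norm0_eq0.

Lemma linfty_cst_subproof (v : V) : (fun _ : G => v) \in linfty_pred.
Proof. by rewrite inE; exists (complex.Re `|v|) => x _; rewrite Re_normE. Qed.

Definition linfty_cst (v : V) : linfty := Linfty (linfty_cst_subproof v).

End linfty.

(* `inner` is linear in the first variable and conjugate-linear in the second. *)
HB.mixin Record isHilbert (R : realType) H of CompleteNormedModule R[i] H := {
  inner : {dot H for @Num.conj R[i]} ;
  normE_inner : forall x : H, `|x| ^+ 2 = inner x x }.

#[short(type="hilbertType")]
HB.structure Definition Hilbert (R : realType) :=
  {H of isHilbert R H & CompleteNormedModule R[i] H}.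

Section bounded_operators.
Variables (R : realType) (H : normedModType R[i]).

Definition bop_pred : {pred H -> H} :=
  mem [set T | linear T /\ exists M : R, forall x, `|T x| <= M%:C * `|x|].

Record bop := Bop { bop_val :> H -> H ; bop_valP : bop_val \in bop_pred }.

HB.instance Definition _ := [isSub for bop_val].
HB.instance Definition _ := [Choice of bop by <:].

Lemma bop_submod_closed : submod_closed bop_pred.
Proof.
split.
  rewrite inE; split=> [a x y|]; first by rewrite scaler0 add0r.
  by exists 0 => x; rewrite normr0 mul0r.
move=> a S T; rewrite !inE => -[lS [M SM]] [lT [N TN]]; split=> [b x y|].
  transitivity (a *: S (b *: x + y) + T (b *: x + y)) => //.
  by rewrite lS lT !scalerDr !scalerA (mulrC a b) addrACA.
exists (complex.Re `|a| * M + N) => x.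
rewrite (_ : _%:C = `|a| * M%:C + N%:C); last first.
  have {1}<- : (complex.Re `|a|)%:C = `|a| by apply: RRe_real; rewrite normr_real.
  by rewrite -rmorphM -rmorphD.
rewrite mulrDl; apply: le_trans (ler_normD _ _) _; apply: lerD; last exact: TN.
by rewrite normrZ -mulrA ler_wpM2l.
Qed.

HB.instance Definition _ :=
  GRing.isSubmodClosed.Build _ _ bop_pred bop_submod_closed.
HB.instance Definition _ := [SubChoice_isSubLmodule of bop by <:].

Lemma bop_linear (T : bop) : linear T.
Proof. by case: T => T /=; rewrite inE => -[]. Qed.

HB.instance Definition _ (T : bop) :=
  GRing.isLinear.Build R[i] H H *:%R T (@bop_linear T).

Lemma bop_bounded (T : bop) : bounded_on [set x : H | `|x| <= 1] T.
Proof.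
case: T => T /=; rewrite inE => -[_ [M TM]]; exists `|M| => x x1.
apply: le_trans (TM x) _; apply: (@le_trans _ _ (`|M|%:C * `|x|)).
  by rewrite ler_wpM2r// lecR ler_norm.
by rewrite ler_piMr// (_ : 0 = 0%:C)// lecR.
Qed.

Definition op_norm (T : bop) : R[i] :=
  (sup_norm [set x : H | `|x| <= 1] T)%:C.

Lemma op_normD S T : op_norm (S + T) <= op_norm S + op_norm T.
Proof. by rewrite -rmorphD lecR; apply: sup_normD; exact: bop_bounded. Qed.

Lemma op_normZ (a : R[i]) T : op_norm (a *: T) = `|a| * op_norm T.
Proof. by apply: sup_normZ; exact: bop_bounded. Qed.

Lemma op_norm0_eq0 T : op_norm T = 0 -> T = 0.
Proof.
move=> T0; apply/val_inj/funext => x /=.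
have [->|x0] := eqVneq x 0; first by rewrite linear0.
have /eqP : T (`|x|^-1 *: x) = 0.
  apply: (sup_norm_eq0 (bop_bounded T) T0).
  by rewrite /= normrZ normfV normr_id mulVf// normr_eq0.
by rewrite linearZ/= scaler_eq0 invr_eq0 normr_eq0 (negPf x0) => /eqP.
Qed.

HB.instance Definition _ := Lmodule_isNormed.Build R[i] bop
  op_normD op_normZ op_norm0_eq0.

Lemma bop_id_subproof : (@id H) \in bop_pred.
Proof. by rewrite inE; split=> //; exists 1 => x; rewrite mul1r. Qed.

Lemma bop_comp_subproof (S T : bop) : S \o T \in bop_pred.
Proof.
rewrite inE; split=> [a x y|]; first by rewrite /= !linearP.
case: (S) (T) => {}S /= + [{}T /= +]; rewrite !inE.
move=> [_ [M SM]] [_ [N TN]]; exists (`|M| * N) => x.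
apply: le_trans (SM _) _; apply: (@le_trans _ _ (`|M|%:C * `|T x|)).
  by rewrite ler_wpM2r// lecR ler_norm.
by rewrite rmorphM -mulrA ler_wpM2l// (_ : 0 = 0%:C)// lecR.
Qed.

Definition bop_id : bop := Bop bop_id_subproof.
Definition bop_comp (S T : bop) : bop := Bop (bop_comp_subproof S T).

Fact bop_compA : associative bop_comp.
Proof. by move=> S T U; exact/val_inj. Qed.

Fact bop_comp1l : left_id bop_id bop_comp.
Proof. by move=> T; exact/val_inj. Qed.

Fact bop_comp1r : right_id bop_id bop_comp.
Proof. by move=> T; exact/val_inj. Qed.

Fact bop_compDl : left_distributive bop_comp +%R.
Proof. by move=> S T U; exact/val_inj. Qed.

Fact bop_compDr : right_distributive bop_comp +%R.
Proof.
by move=> S T U; apply/val_inj/funext => x; exact: (linearD S).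
Qed.

HB.instance Definition _ := GRing.Zmodule_isPzRing.Build bop
  bop_compA bop_comp1l bop_comp1r bop_compDl bop_compDr.

End bounded_operators.

Section hilbert_operators.
Variables (R : realType) (H : hilbertType R).
Implicit Types S T : bop H.

(* Such an S exists and is unique by the Riesz representation theorem. *)
Definition adjoint T : bop H :=
  xget (0 : bop H) [set S | forall x y : H, inner (T x) y = inner x (S y)].

Definition positive_op T : Prop := forall v : H, 0 <= inner (T v) v.

(* positivity of the operator (T i j)_ij acting on the n-fold direct sum of H *)
Definition positive_op_matrix n (T : 'I_n -> 'I_n -> bop H) : Prop :=
  forall v : 'I_n -> H, 0 <= \sum_i \sum_j inner (T i j (v j)) (v i).

Definition square_summable (xi : nat -> H) : Prop :=
  cvgn (series (fun n => `|xi n| ^+ 2 : R[i]^o)).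

Definition vector_series (xi eta : nat -> H) T : R[i] :=
  limn (series (fun n => inner (T (xi n)) (eta n) : R[i]^o)).

(* The ultraweak topology is the locally convex topology given by the seminorms
   T |-> |vector_series xi eta T|, for square-summable xi and eta. *)
Definition ultraweakly_continuous (Phi : bop H -> R[i]) : Prop :=
  forall T0 (e : R), 0 < e ->
  exists (m : nat) (xi eta : 'I_m -> nat -> H) (d : R),
  [/\ 0 < d,
      forall k, square_summable (xi k) /\ square_summable (eta k) &
      forall T, (forall k, `|vector_series (xi k) (eta k) (T - T0)| < d%:C) ->
                `|Phi T - Phi T0| < e%:C].

End hilbert_operators.

Section group_functions.
Variables (R : realType) (G : groupType).

Lemma left_translate_subproof (V : normedModType R[i]) (x : G)
  (f : linfty G V) : (fun y => f (x^-1 * y)%g) \in @linfty_pred R G V.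
Proof.
by rewrite inE; have [M fM] := linfty_bounded f; exists M => y _; exact: fM.
Qed.

Definition left_translate (V : normedModType R[i]) (x : G) (f : linfty G V) :
  linfty G V := Linfty (left_translate_subproof x f).

Definition is_state (m : {scalar linfty G R[i]^o}) : Prop :=
  (forall f : linfty G R[i]^o, (forall x, 0 <= f x) -> 0 <= m f) /\ m (linfty_cst G (1 : R[i]^o)) = 1.

Definition amenable : Prop :=
  exists m : {scalar linfty G R[i]^o},
    is_state m /\ forall x f, m (left_translate x f) = m f.

(* m_y f(y) for bounded f; an unbounded f is sent to m 0 = 0. *)
Definition state_at (m : {scalar linfty G R[i]^o}) (f : G -> R[i]) : R[i] :=
  m (insubd (0 : linfty G R[i]^o) f).

Definition positive_definite (H : hilbertType R) (psi : G -> bop H) : Prop :=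
  forall n (x : 'I_n -> G), injective x ->
  positive_op_matrix (fun i j => psi ((x i)^-1 * x j)%g).

End group_functions.

(* Main.v *)
Require Import Defs.
From HB Require Import structures.
From mathcomp Require Import all_boot all_order all_algebra.
From mathcomp Require Import complex.
From mathcomp Require Import boolp classical_sets functions reals topology.
From mathcomp Require Import normedtype sequences.
From mathcomp Require Import ring lra.

Set Implicit Arguments.
Unset Strict Implicit.
Unset Printing Implicit Defensive.

Import Order.TTheory GRing.Theory Num.Theory.
Import numFieldNormedType.Exports.

Local Open Scope classical_set_scope.
Local Open Scope complex_scope.
Local Open Scope ring_scope.

(** The proof goes round the circle: an invariant mean gives the form, the
form gives an invariant mean and hence the correlation state, and a
correlation state is itself an invariant mean.  Two devices carry it.

Averaging operators.  For a state m on the bounded functions and a bounded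
phi : G -> B(H), the sesquilinear form (u, v) |-> m_y <phi(y) u, v> is bounded,
so by the Riesz representation theorem it is the form of an operator, the
weak mean of phi ([op_mean]).  If m is left-invariant, the correlation
x |-> mean_y phi(x y) phi(y)^adj is positive definite: substituting
x_j^-1 y for y, its value at x_i^-1 x_j becomes
mean_y phi(x_i^-1 y) phi(x_j^-1 y)^adj, a mean of Gram matrices
([correlation_posdef]).  Therefore <phi, chi> = mean_y chi(y) phi(y)^adj is a
form as required ([amenable_form]), and the correlation of phi is the map psi
required of the state ([amenable_correlation]).  In the latter the identity
has to be checked against every ultraweakly continuous functional; such a
functional is a finite combination of series sum_n <T xi_n, eta_n>
([ultraweak_span]), whose tails are uniformly small on bounded sets of
operators, so that it commutes with the mean ([ultraweak_op_mean]).

Hermitian symmetry and polarization.  If psi is positive definite then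
<psi(x^-1) v, v> is the conjugate of <psi(x) v, v> ([posdef_conj]).  The maps
psi at hand depend quadratically on phi, and polarizing this symmetry in phi
yields linear statements.

Given a form, choose v with <<1, 1> v, v> nonzero and let
b(chi, phi) = <<phi, chi> v, v>.  The symmetry says that
b(chi, lambda(x)^-1 phi) - b(lambda(x) chi, phi) vanishes for chi = phi, hence
always ([scalar_form_translate]).  As the constant 1 is fixed by lambda, the
functional f |-> b(f 1, 1) is translation invariant; by the Cauchy-Schwarz
inequality it is bounded, and it is positive at 1.  It need not be a positive
functional, but its positive part u |-> sup over 0 <= w <= u of its values is
additive and still invariant, and after normalization it is an invariant mean
([amenable_of_shift_invariant]).

Given a correlation state tau, apply its property to phi(y) = f(y) Id with f
scalar and nowhere zero, so that the factor coming from phi(x)^adj can be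
cancelled.  The symmetry becomes an identity that is quadratic in f
([correlation_hermitian]).  Comparing f = t + g with f = t - g for a large
constant t isolates the part linear in g ([correlation_polarized]), and
comparing g with i g leaves tau(lambda(x) g) = tau(g)
([correlation_amenable]). *)

(** * Positive sesquilinear forms *)

(** Expanding a positive form at u + v and at u + i v shows that the two sums
below are real for a = f u v and b = f v u; that is all hermitian symmetry
needs. *)
Lemma conj_of_real (C : numClosedFieldType) (a b : C) :
  a + b \is Num.real -> 'i * (b - a) \is Num.real -> b = a^*.
Proof.
move=> /CrealP h1 /CrealP; rewrite rmorphM/= conjCi !rmorphB/= mulNr -mulrN.
move/(mulfI (neq0Ci C)) => h2; move: h1; rewrite rmorphD/= => h1.
have : 2 * b = 2 * a^*.
  transitivity ((a + b) + (b - a)); first by ring.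
  by rewrite -h1 -h2; ring.
by move/(mulfI _); apply; rewrite pnatr_eq0.
Qed.

Section positive_forms.
Variables (C : numClosedFieldType) (V : lmodType C).
Variable f : {bilinear V -> V -> C | *%R & Num.conj \; *%R}.

Lemma form_lincomb a b u v : f (a *: u + b *: v) (a *: u + b *: v) =
  a * a^* * f u u + a * b^* * f u v + b * a^* * f v u + b * b^* * f v v.
Proof. by rewrite linearDl !linearDr !linearZl_LR !linearZr_LR/=; ring. Qed.

(** Polarization: the diagonal values at u + v and at u + i v give
f u v = - f v u and f u v = f v u. *)
Lemma form_eq0 : (forall u, f u u = 0) -> forall u v, f u v = 0.
Proof.
move=> f0 u v.
have := f0 (u + v); rewrite linearDl !linearDr !f0 add0r addr0 => /eqP.
rewrite addr_eq0 => /eqP fuv.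
have := f0 (u + 'i *: v).
rewrite linearDl !linearDr !linearZl_LR !linearZr_LR/= !f0 add0r.
rewrite mulr0 mulr0 addr0 conjCi fuv mulrN mulNr opprK -mulr2n => /eqP.
by rewrite mulrn_eq0/= mulf_eq0 (negPf (neq0Ci C))/= => /eqP->; rewrite oppr0.
Qed.

Hypothesis f_ge0 : forall u, 0 <= f u u.

Lemma psd_form_conj u v : f v u = (f u v)^*.
Proof.
have r w : f w w \is Num.real by rewrite ger0_real.
have h1 : f u v + f v u \is Num.real.
  have := r (u + v); rewrite linearDl !linearDr => h.
  have -> : f u v + f v u = f u u + f u v + (f v u + f v v) - f u u - f v v by ring.
  by rewrite !realB.
have h2 : 'i * (f v u - f u v) \is Num.real.
  have := r (u + 'i *: v).
  rewrite linearDl !linearDr !linearZl_LR !linearZr_LR/= conjCi => h.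
  have -> : 'i * (f v u - f u v) =
     f u u + - 'i * f u v + ('i * f v u + 'i * (- 'i * f v v)) - f u u - f v v.
    have := sqrCi C; rewrite expr2 => i2.
    by rewrite mulrA mulrN i2; ring.
  by rewrite !realB.
exact: conj_of_real.
Qed.

(** Positivity at f(v, v) u - f(u, v) v is f(v, v) times the claim.  When
f(v, v) = 0 the roles of u and v are exchanged, and when f(u, u) = 0 as well,
positivity at u - f(u, v) v forces f(u, v) = 0. *)
Lemma psd_form_CauchySchwarz u v : `|f u v| ^+ 2 <= f u u * f v v.
Proof.
wlog : u v / f v v != 0 => [hw|v0].
  have [v0|] := eqVneq (f v v) 0; last exact: hw.
  have [u0|u0] := eqVneq (f u u) 0; last first.
    by rewrite mulrC psd_form_conj norm_conjC; exact: hw.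
  have := f_ge0 (1 *: u + (- f u v) *: v).
  rewrite form_lincomb u0 v0 (psd_form_conj u v) rmorphN rmorph1/= => h.
  rewrite mul0r -oppr_ge0 -(pmulrn_lge0 _ (isT : (0 < 2)%N)) normCK.
  by apply: (le_trans h); rewrite le_eqVlt; apply/orP; left; apply/eqP; ring.
have vp : 0 < f v v by rewrite lt_def v0 f_ge0.
have := f_ge0 (f v v *: u + (- f u v) *: v).
rewrite form_lincomb (psd_form_conj u v) rmorphN (CrealP (ger0_real (f_ge0 v)))/= => h.
rewrite -subr_ge0 -(pmulr_rge0 _ vp) normCK.
by apply: (le_trans h); rewrite le_eqVlt; apply/orP; left; apply/eqP; ring.
Qed.

End positive_forms.

(** * Inner products and the Riesz representation theorem *)
Section hilbert.
Variables (R : realType) (H : hilbertType R).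
Implicit Types u v : H.

Lemma innerDl u v w : inner (u + v) w = inner u w + inner v w.
Proof. exact: linearDl. Qed.

Lemma innerBl u v w : inner (u - v) w = inner u w - inner v w.
Proof. exact: linearBl. Qed.

Lemma innerZl a u w : inner (a *: u) w = a * inner u w.
Proof. exact: linearZl_LR. Qed.

Lemma innerDr u v w : inner w (u + v) = inner w u + inner w v.
Proof. exact: linearDr. Qed.

Lemma innerBr u v w : inner w (u - v) = inner w u - inner w v.
Proof. exact: linearBr. Qed.

Lemma innerZr a u w : inner w (a *: u) = Num.conj a * inner w u.
Proof. exact: linearZr_LR. Qed.

Lemma inner_ge0 u : 0 <= inner u u.
Proof. by rewrite -normE_inner exprn_ge0. Qed.

Lemma inner_conj u v : inner v u = Num.conj (inner u v).
Proof. by apply: psd_form_conj; exact: inner_ge0. Qed.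

Lemma norm_inner u v : `|inner u v| <= `|u| * `|v|.
Proof.
rewrite -ler_sqr ?nnegrE ?mulr_ge0// exprMn !normE_inner.
by apply: psd_form_CauchySchwarz; exact: inner_ge0.
Qed.

Lemma inner_extl u v : (forall w, inner u w = inner v w) -> u = v.
Proof.
move=> uv; apply/eqP; rewrite -subr_eq0 -normr_eq0 -sqrf_eq0 normE_inner.
by rewrite innerBl uv subrr.
Qed.

End hilbert.

Lemma real_complexM (R : realType) (a b : R) : (a * b)%:C = a%:C * b%:C.
Proof. exact: rmorphM. Qed.

Lemma ltr0c (R : realType) (a : R) : (0 < a%:C) = (0 < a).
Proof. exact: (ltcR 0 a). Qed.

Lemma eq0_small (R : realType) (a b : R[i]) : 0 <= b ->
  (forall e : R, 0 < e -> `|a| <= e%:C * b) -> a = 0.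
Proof.
move=> b0 ab; apply/eqP; rewrite -normr_eq0 eq_le normr_ge0 andbT.
have /complex_realP[r rE] := ger0_real (normr_ge0 a).
have /complex_realP[s sE] := ger0_real b0.
rewrite rE (_ : 0 = 0%:C)// lecR; apply/ler_addgt0Pr => e e0; rewrite add0r.
have s0 : 0 <= s by move: b0; rewrite sE ler0c.
have := ab _ (divr_gt0 e0 (ltr_wpDl s0 ltr01)).
rewrite rE sE -rmorphM lecR => /le_trans; apply.
by rewrite mulrAC ler_pdivrMr ?ltr_wpDl// ler_pM2l// lerDl ler01.
Qed.

Section riesz.
Variables (R : realType) (H : hilbertType R).
Local Notation C := R[i].

Section approx.
Variables (f : {scalar H}) (M : R).
Hypothesis fM : forall x, `|f x| <= M%:C * `|x|.

Let J x : C := `|x| ^+ 2 - 2 * 'Re (f x).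

Let J_real x : J x = (complex.Re (J x))%:C.
Proof. by rewrite RRe_real// realB ?realM ?realX ?normr_real ?Creal_Re ?realn. Qed.

Let J_ge x : - (M ^+ 2)%:C <= J x.
Proof.
rewrite -subr_ge0 /J.
have h : 'Re (f x) <= M%:C * `|x|.
  by apply: le_trans (fM x); exact: (leif_Re_Creal _).1.
apply: (@le_trans _ _ (`|x| ^+ 2 - 2 * (M%:C * `|x|) - - (M ^+ 2)%:C)).
  have -> : `|x| ^+ 2 - 2 * (M%:C * `|x|) - - (M ^+ 2)%:C = (`|x| - M%:C) ^+ 2.
    by rewrite rmorphXn/=; ring.
  by rewrite real_exprn_even_ge0// realB ?normr_real// complex_real.
by rewrite lerD2r lerD2l lerN2 ler_wpM2l.
Qed.

Let J_shift x w (t : C) :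
  J (x + t *: w) = J x + `|t| ^+ 2 * `|w| ^+ 2 + 2 * 'Re (t * (inner w x - f w)).
Proof.
rewrite /J !normE_inner innerDl !innerDr !innerZl !innerZr.
rewrite !normCK (inner_conj w x) mulrBr raddfB/=.
have -> : f (x + t *: w) = f x + t * f w by rewrite linearD linearZ.
rewrite [X in 2 * X]raddfD/=.
have -> : 'Re (t * inner w x) = (t * inner w x + Num.conj t * Num.conj (inner w x)) / 2.
  by rewrite ReE rmorphM.
by field.
Qed.

(** An almost minimizer x of J(x) = |x|^2 - 2 Re f(x) almost represents f.
With g = <w, x> - f(w), the step - conj(g) / |w|^2 in the direction w lowers J
by exactly |g|^2 / |w|^2, and if J(x) is within e^2 of the infimum this gain is
at most e^2. *)
Lemma riesz_approx (e : R) : 0 < e ->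
  exists x, forall w, `|inner w x - f w| <= e%:C * `|w|.
Proof.
move=> e0; pose A := range (fun x => complex.Re (J x)).
have Ainf : has_inf A.
  split; first by exists (complex.Re (J 0)), 0.
  exists (- M ^+ 2) => _ [x _ <-].
  by rewrite -lecR -J_real rmorphN; exact: J_ge.
have [_ [x _ <-] xlt] := inf_adherent (exprn_gt0 2 e0) Ainf.
exists x => w; have [->|w0] := eqVneq w 0.
  by rewrite linear0 linear0l subr0 !normr0 mulr0.
have wp : 0 < `|w| ^+ 2 by rewrite exprn_gt0// normr_gt0.
set g := inner w x - f w.
have lb : inf A <= complex.Re (J (x + (- Num.conj g / `|w| ^+ 2) *: w)).
  apply: ge_inf; last by exists (x + (- Num.conj g / `|w| ^+ 2) *: w).
  exact: (proj2 Ainf).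
(* The optimal step along w. *)
have Jw : J (x + (- Num.conj g / `|w| ^+ 2) *: w) = J x - `|g| ^+ 2 / `|w| ^+ 2.
  rewrite J_shift -/g.
  have -> : - Num.conj g / `|w| ^+ 2 * g = - (`|g| ^+ 2 / `|w| ^+ 2).
    by rewrite [in RHS]normCK; field; rewrite normr_eq0.
  rewrite normrM normrN norm_conjC normfV normrX normr_id.
  rewrite (Creal_ReP _ _); last by rewrite realN realM ?realV ?realX ?normr_real.
  by field; rewrite normr_eq0.
have wn0 : `|w| != 0 by rewrite normr_eq0.
move: lb xlt; rewrite -lecR -ltcR -J_real Jw rmorphD/= -J_real => lb xlt.
have : `|g| ^+ 2 / `|w| ^+ 2 <= (e ^+ 2)%:C.
  rewrite -(lerD2l ((inf A)%:C)); apply: ltW; apply: le_lt_trans xlt.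
  by rewrite -lerBrDr.
rewrite ler_pdivrMr// rmorphXn/= -exprMn ler_sqr ?nnegrE ?mulr_ge0//.
by rewrite ler0c ltW.
Qed.

End approx.

(** The vectors that represent f up to e form a Cauchy filter as e tends to
0: two of them, tested against their difference, are at distance at most 2 e.
Its limit represents f exactly. *)
Lemma riesz (f : {scalar H}) (M : R) : (forall x, `|f x| <= M%:C * `|x|) ->
  exists z, forall w, f w = inner w z.
Proof.
move=> fM.
pose A (e : R) := [set x | forall w, `|inner w x - f w| <= e%:C * `|w|].
pose F := filter_from [set e : R | 0 < e] A.
have FF : ProperFilter F.
  apply: filter_from_proper; last first.
    by move=> e /= e0; have [x hx] := riesz_approx fM e0; exists x.
  apply: filter_from_filter; first by exists 1; rewrite /= ltr01.
  move=> i j /= i0 j0; exists (Num.min i j); first by rewrite /= lt_min i0.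
  by move=> x Ax; split=> w; apply: le_trans (Ax w) _;
    rewrite ler_wpM2r// lecR ge_min lexx ?orbT.
have : cauchy F.
  apply: cauchy_exP => e e0.
  have /complex_realP[r rE] := gtr0_real e0.
  have r0 : 0 < r by move: e0; rewrite rE ltr0c.
  have r4 : 0 < r / 4 by rewrite divr_gt0.
  have [x Ax] := riesz_approx fM r4.
  exists x; exists (r / 4) => // y Ay; rewrite -ball_normE/=.
  have [->|xy] := eqVneq x y; first by rewrite subrr normr0.
  have w0 : 0 < `|x - y| by rewrite normr_gt0 subr_eq0.
  apply: (@le_lt_trans _ _ (r / 2)%:C); last by rewrite rE ltcR; lra.
  rewrite -(ler_pM2r w0) -expr2 normE_inner.
  rewrite -[X in X <= _]ger0_norm ?inner_ge0// innerBr.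
  have -> : inner (x - y) x - inner (x - y) y =
     (inner (x - y) x - f (x - y)) - (inner (x - y) y - f (x - y)) by ring.
  apply: le_trans (ler_normB _ _) _; apply: le_trans (lerD (Ax _) (Ay _)) _.
  by rewrite -mulrDl -rmorphD (_ : r / 4 + r / 4 = r / 2)//; field.
move=> /cauchy_cvg/cvg_ex[z Fz]; exists z => w; apply/eqP; rewrite eq_sym -subr_eq0.
apply/eqP; apply: (@eq0_small _ _ (2 * `|w|)); first by rewrite mulr_ge0.
move=> e e0; have eC : 0 < e%:C by rewrite ltr0c.
have FA : F (A e) by exists e.
have [x [xz Ax]] := filter_ex (filterI (Fz _ (nbhsx_ballx z _ eC)) FA).
have -> : inner w z - f w = inner w (z - x) + (inner w x - f w).
  by rewrite innerBr; ring.
apply: le_trans (ler_normD _ _) _.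
rewrite mulrCA mulr_natl mulr2n; apply: lerD (Ax w).
apply: le_trans (norm_inner _ _) _; rewrite mulrC ler_wpM2r//.
by move: xz; rewrite -ball_normE => /ltW.
Qed.

End riesz.

(** * Bounded operators and adjoints *)
Section norms.
Variable R : realType.
Local Notation C := R[i].

Lemma linfty_norm_ub (G : Type) (V : normedModType C) (f : linfty G V) x :
  `|f x| <= `|f|.
Proof. by apply: sup_norm_ub => //; exact: linfty_bounded. Qed.

Lemma linfty_norm_le (G : Type) (V : normedModType C) (f : linfty G V) (M : C) :
  0 <= M -> (forall x, `|f x| <= M) -> `|f| <= M.
Proof.
move=> M0 fM; have /complex_realP[r rE] := ger0_real M0.
rewrite rE; change ((sup_norm setT f)%:C <= r%:C); rewrite lecR; apply: sup_norm_le.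
  by move: M0; rewrite rE ler0c.
by move=> x _; rewrite -rE.
Qed.

Variable H : normedModType C.
Implicit Types S T : bop H.

Lemma op_norm_ub T x : `|T x| <= `|T| * `|x|.
Proof.
have [->|x0] := eqVneq x 0; first by rewrite linear0 !normr0 mulr0.
have xp : 0 < `|x| by rewrite normr_gt0.
have -> : T x = `|x| *: T (`|x|^-1 *: x).
  by rewrite linearZ scalerA divff ?scale1r// gt_eqF.
rewrite normrZ normr_id mulrC ler_wpM2r//; apply: sup_norm_ub.
  exact: bop_bounded.
by rewrite /= normrZ normfV normr_id mulVf// gt_eqF.
Qed.

Lemma op_norm_le T (M : C) : 0 <= M -> (forall x, `|T x| <= M * `|x|) -> `|T| <= M.
Proof.
move=> M0 TM; have /complex_realP[r rE] := ger0_real M0.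
rewrite rE; change ((sup_norm [set x : H | `|x| <= 1] T)%:C <= r%:C).
rewrite lecR; apply: sup_norm_le.
  by move: M0; rewrite rE ler0c.
move=> x /= x1; rewrite -rE; apply: le_trans (TM x) _.
by rewrite -[leRHS]mulr1 ler_wpM2l.
Qed.

Lemma op_normM S T : `|S * T| <= `|S| * `|T|.
Proof.
apply: op_norm_le => [|x]; first by rewrite mulr_ge0.
apply: le_trans (op_norm_ub S (T x)) _.
by rewrite -mulrA ler_wpM2l// op_norm_ub.
Qed.

End norms.

Section operators.
Variables (R : realType) (H : hilbertType R).
Local Notation C := R[i].
Implicit Types S T : bop H.

Lemma bop_inner_ext S T : (forall u v, inner (S u) v = inner (T u) v) -> S = T.
Proof.
by move=> ST; apply/val_inj/funext => u; apply: inner_extl => v; exact: ST.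
Qed.

(** For fixed u the functional v |-> conj (q u v) is linear and bounded, so the
Riesz theorem provides T u; uniqueness of the representing vector makes T
linear. *)
Lemma sesquilinear_bop (q : H -> H -> C) (M : R) :
  0 <= M ->
  (forall v, scalar (q^~ v)) ->
  (forall u a v w, q u (a *: v + w) = Num.conj a * q u v + q u w) ->
  (forall u v, `|q u v| <= M%:C * `|u| * `|v|) ->
  exists T : bop H, forall u v, inner (T u) v = q u v.
Proof.
move=> M0 ql qr qM.
have q_riesz u : exists z, forall v, inner z v = q u v.
  have l : scalar (fun v => Num.conj (q u v)).
    by move=> a v w; rewrite qr rmorphD rmorphM/= conjCK.
  pose f : {scalar H} := HB.pack (fun v => Num.conj (q u v))
    (GRing.isLinear.Build _ _ _ _ _ l).
  have [|z zE] := @riesz _ _ f (M * complex.Re `|u|).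
    by move=> v; rewrite rmorphM/= Re_normE norm_conjC.
  by exists z => v; rewrite inner_conj -zE/= conjCK.
have [T TE] := choice q_riesz.
have Tlin : linear T.
  move=> a u w; apply: inner_extl => v.
  by rewrite innerDl innerZl !TE ql.
have Tbop : T \in @bop_pred R H.
  rewrite inE; split=> //; exists M => u.
  have [->|Tu0] := eqVneq (T u) 0.
    by rewrite normr0 mulr_ge0// ler0c.
  rewrite -(@ler_pM2r _ `|T u|) ?normr_gt0// -expr2 normE_inner TE.
  apply: le_trans (qM _ _).
  by rewrite real_ler_norm// -TE ger0_real ?inner_ge0.
by exists (Bop Tbop).
Qed.

(** Existence of the adjoint: without it the choice operator in the definition
of [adjoint] would return its default value 0. *)
Lemma inner_adjoint T u v : inner (T u) v = inner u (adjoint T v).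
Proof.
rewrite /adjoint; case: xgetP => [S _ + //|/= noS].
suff [S SE] : exists S : bop H, forall x y, inner (T x) y = inner x (S y).
  by have := noS S SE.
have [||||S SE] := @sesquilinear_bop (fun x y => inner x (T y)) (complex.Re `|T|).
- by rewrite -lecR Re_normE; exact: normr_ge0.
- by move=> w a x y; rewrite innerDl innerZl.
- by move=> x a y z; rewrite linearP innerDr innerZr.
- move=> x y; rewrite Re_normE; apply: le_trans (norm_inner _ _) _.
  by rewrite [leRHS]mulrAC [leLHS]mulrC ler_wpM2r// op_norm_ub.
by exists S => x y; rewrite inner_conj -SE -inner_conj.
Qed.

Lemma inner_adjointl T u v : inner (adjoint T u) v = inner u (T v).
Proof. by rewrite inner_conj -inner_adjoint -inner_conj. Qed.

Lemma adjoint_unique S T : (forall u v, inner (T u) v = inner u (S v)) -> adjoint T = S.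
Proof.
move=> TS; apply: bop_inner_ext => u v.
by rewrite inner_adjointl [RHS]inner_conj -TS -inner_conj.
Qed.

Lemma adjointD S T : adjoint (S + T) = adjoint S + adjoint T.
Proof.
by apply: adjoint_unique => u v; rewrite /= innerDl innerDr !inner_adjoint.
Qed.

Lemma adjointZ a T : adjoint (a *: T) = Num.conj a *: adjoint T.
Proof.
by apply: adjoint_unique => u v; rewrite /= innerZl innerZr conjCK inner_adjoint.
Qed.

Lemma norm_adjoint T : `|adjoint T| <= `|T|.
Proof.
apply: op_norm_le => // u.
have [->|Tu0] := eqVneq (adjoint T u) 0; first by rewrite normr0 mulr_ge0.
rewrite -(@ler_pM2r _ `|adjoint T u|) ?normr_gt0// -expr2 normE_inner.
rewrite -[leLHS]ger0_norm ?inner_ge0// -inner_adjoint.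
apply: le_trans (norm_inner _ _) _.
by rewrite [leRHS]mulrAC ler_wpM2r// op_norm_ub.
Qed.

End operators.

(** * States on bounded functions *)
Section states.
Variables (R : realType) (G : groupType).
Local Notation C := R[i].
Local Notation bounded f := (@bounded_on R G C^o setT f).
Variable m : {scalar linfty G C^o}.
Implicit Types f g : G -> C.

Lemma bounded_on_le f (M : C) : (forall y, `|f y| <= M) -> bounded f.
Proof.
move=> fM; exists (complex.Re M) => y _; rewrite RRe_real ?fM//.
by rewrite ger0_real// (le_trans _ (fM 1%g)).
Qed.

Lemma bounded_on_cst (c : C) : bounded (fun=> c).
Proof. by apply: (@bounded_on_le _ `|c|). Qed.

Lemma bounded_on_lincomb (a : C) f g :
  bounded f -> bounded g -> bounded (fun y => a * f y + g y).
Proof. exact: bounded_onP. Qed.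

Lemma bounded_onZ (a : C) f : bounded f -> bounded (fun y => a * f y).
Proof.
move=> bf; have := bounded_on_lincomb a bf (bounded_on_cst 0).
by congr (bounded_on _ _); apply/funext => y; rewrite addr0.
Qed.

Lemma bounded_onM f g : bounded f -> bounded g -> bounded (fun y => f y * g y).
Proof.
move=> [M fM] [N gN]; apply: (@bounded_on_le _ (M%:C * N%:C)) => y.
by rewrite normrM ler_pM ?fM ?gN.
Qed.

Lemma bounded_on_comp f (h : G -> G) : bounded f -> bounded (f \o h).
Proof. by move=> [M fM]; exists M => y _; exact: fM. Qed.

Lemma bounded_on_conj f : bounded f -> bounded (fun y => Num.conj (f y)).
Proof. by move=> [M fM]; exists M => y _; rewrite norm_conjC; exact: fM. Qed.

Lemma insubd_linftyE f : bounded f -> insubd (0 : linfty G C^o) f = f :> (G -> C).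
Proof. by move=> bf; rewrite insubdK// inE. Qed.

Lemma state_at_val (f : linfty G C^o) : state_at m f = m f.
Proof. by rewrite /state_at valKd. Qed.

Lemma state_at_lincomb (a : C) f g : bounded f -> bounded g ->
  state_at m (fun y => a * f y + g y) = a * state_at m f + state_at m g.
Proof.
move=> bf bg; rewrite /state_at -[RHS](linearP m); congr (m _).
apply/val_inj => /=; rewrite insubd_linftyE; last exact: bounded_on_lincomb.
by apply/funext => y /=; rewrite -{1}(insubd_linftyE bf) -{1}(insubd_linftyE bg).
Qed.

Hypothesis m_state : is_state m.

Lemma state_at_cst c : state_at m (fun=> c) = c.
Proof.
have -> : (fun=> c) = linfty_cst G (c : C^o) :> (G -> C) by [].
rewrite state_at_val.
have -> : linfty_cst G (c : C^o) = c *: linfty_cst G (1 : C^o).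
  by apply/val_inj/funext => y; symmetry; exact: (mulr1 c).
by rewrite linearZ/= m_state.2 mulr1.
Qed.

Lemma state_atZ (a : C) f : bounded f ->
  state_at m (fun y => a * f y) = a * state_at m f.
Proof.
move=> bf; have := state_at_lincomb a bf (bounded_on_cst 0).
rewrite state_at_cst addr0 => <-.
by congr state_at; apply/funext => y; rewrite addr0.
Qed.

Lemma state_at_ge0 f : bounded f -> (forall y, 0 <= f y) -> 0 <= state_at m f.
Proof.
by move=> bf f0; apply: m_state.1 => y; rewrite insubd_linftyE.
Qed.

(** For |f| <= M the function f + M is nonnegative, so its mean is real. *)
Lemma state_at_real f : bounded f -> (forall y, f y \is Num.real) ->
  state_at m f \is Num.real.
Proof.
move=> bf fr; have [M fM] := bf.
have -> : state_at m f = (1 * state_at m f + state_at m (fun=> M%:C)) - M%:C.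
  by rewrite state_at_cst; ring.
rewrite -state_at_lincomb//; last exact: bounded_on_cst.
rewrite realB ?complex_real// ger0_real// state_at_ge0//.
  by apply: bounded_on_lincomb => //; exact: bounded_on_cst.
move=> y; rewrite mul1r addrC -lerBlDl sub0r.
have := fM y I; rewrite real_ler_norml// => /andP[+ _].
by [].
Qed.

Lemma bounded_on_sum (I : Type) (r : seq I) (F : I -> G -> C) :
  (forall i, bounded (F i)) -> bounded (fun y => \sum_(i <- r) F i y).
Proof.
move=> bF; elim: r => [|i r ihr].
  by have := bounded_on_cst 0; congr (bounded_on _ _); apply/funext => y; rewrite big_nil.
have := bounded_on_lincomb 1 (bF i) ihr; congr (bounded_on _ _); apply/funext => y.
by rewrite big_cons mul1r.
Qed.

Lemma state_at_sum (I : Type) (r : seq I) (F : I -> G -> C) :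
  (forall i, bounded (F i)) ->
  state_at m (fun y => \sum_(i <- r) F i y) = \sum_(i <- r) state_at m (F i).
Proof.
move=> bF; elim: r => [|i r ihr].
  rewrite big_nil -[RHS]state_at_cst; congr state_at.
  by apply/funext => y; rewrite big_nil.
rewrite big_cons -ihr -[X in X + _]mul1r -state_at_lincomb//; last exact: bounded_on_sum.
by congr state_at; apply/funext => y; rewrite big_cons mul1r.
Qed.

Lemma state_at_conj f : bounded f ->
  state_at m (fun y => Num.conj (f y)) = Num.conj (state_at m f).
Proof.
move=> bf; have bcf := bounded_on_conj bf.
apply: conj_of_real.
  rewrite -[X in X + _]mul1r -state_at_lincomb//; apply: state_at_real.
    exact: bounded_on_lincomb.
  by move=> y; apply/CrealP; rewrite rmorphD rmorphM/= conjCK rmorph1; ring.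
have b0 := @bounded_on_cst 0.
have bif := bounded_on_lincomb (- 'i) bf b0.
have -> : 'i * (state_at m (fun y => Num.conj (f y)) - state_at m f) =
    'i * state_at m (fun y => Num.conj (f y)) +
    ((- 'i) * state_at m f + state_at m (fun=> 0)).
  by rewrite state_at_cst; ring.
rewrite -!state_at_lincomb//; apply: state_at_real.
  exact: bounded_on_lincomb.
move=> y; apply/CrealP; rewrite !rmorphD/= !rmorphM/= conjCK rmorphN/= conjCi rmorph0.
ring.
Qed.

(** Multiplying f by a unimodular constant c makes the mean of c f equal to
minus its modulus; then M + Re (c f) >= 0 has a nonnegative mean. *)
Lemma state_at_norm f (M : C) : (forall y, `|f y| <= M) -> `|state_at m f| <= M.
Proof.
move=> fM; have bf := bounded_on_le fM.
have M0 : 0 <= M by apply: le_trans (fM 1%g).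
set t := state_at m f.
have [->|t0] := eqVneq t 0; first by rewrite normr0.
pose c := - Num.conj t / `|t|.
have tn0 : `|t| != 0 by rewrite normr_eq0.
have bcf := bounded_on_lincomb c bf (bounded_on_cst M).
have : 0 <= state_at m (fun y => 1 * (c * f y + M) + Num.conj (c * f y + M)).
  apply: state_at_ge0; first by apply: bounded_on_lincomb => //; exact: bounded_on_conj.
  move=> y; rewrite mul1r.
  set w := c * f y; have : 'Re (- w) <= M.
    apply: le_trans (leif_Re_Creal _).1 _; rewrite normrN normrM normrM normrN.
    by rewrite norm_conjC normfV normr_id divff// mul1r.
  rewrite -subr_ge0 ReE rmorphN => h; rewrite rmorphD/=.
  rewrite (CrealP (ger0_real M0)) -(@pmulr_lge0 _ 2^-1) ?invr_gt0//.
  by apply: (le_trans h); rewrite le_eqVlt; apply/orP; left; apply/eqP; field.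
rewrite state_at_lincomb//; last exact: bounded_on_conj.
rewrite state_at_conj// state_at_lincomb//; last exact: bounded_on_cst.
rewrite state_at_cst -/t.
have -> : c * t = - `|t|.
  rewrite /c mulrAC mulNr (mulrC _ t) -normCK; field.
  by [].
rewrite mul1r (CrealP _); last by rewrite realD ?realN ?normr_real ?ger0_real.
by rewrite -mulr2n pmulrn_lge0// addrC subr_ge0.
Qed.

Lemma state_at_translate : 
    (forall x (f : linfty G C^o), m (left_translate x f) = m f) ->
  forall x f, bounded f -> state_at m (fun y => f (x * y)%g) = state_at m f.
Proof.
move=> minv x f bf; rewrite /state_at -[RHS](minv x^-1%g); congr (m _).
apply/val_inj => /=; rewrite insubd_linftyE; last first.
  exact: (bounded_on_comp (fun y => x * y)%g bf).
by apply/funext => y /=; rewrite insubd_linftyE// invgK.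
Qed.

End states.

(** * Weak means of operator-valued functions *)
Section operator_means.
Variables (R : realType) (G : groupType) (H : hilbertType R).
Local Notation C := R[i].
Local Notation bounded phi := (@bounded_on R G (bop H) setT phi).
Variable m : {scalar linfty G C^o}.
Implicit Types phi chi : G -> bop H.

Definition op_mean phi : bop H :=
  xget 0 [set S : bop H | forall u v,
    inner (S u) v = state_at m (fun y => inner (phi y u) v)].

Lemma bounded_inner phi u v : bounded phi ->
  @bounded_on R G C^o setT (fun y => inner (phi y u) v).
Proof.
move=> [M phiM]; apply: (@bounded_on_le _ _ _ (M%:C * `|u| * `|v|)) => y.
apply: le_trans (norm_inner _ _) _; rewrite ler_wpM2r//.
apply: le_trans (op_norm_ub _ _) _; rewrite ler_wpM2r//; exact: phiM.
Qed.

Lemma bounded_linfty (phi : linfty G (bop H)) : bounded phi.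
Proof. exact: linfty_bounded. Qed.

Lemma bounded_op_comp phi (h : G -> G) : bounded phi -> bounded (phi \o h).
Proof. by move=> [M phiM]; exists M => y _; exact: phiM. Qed.

Lemma bounded_adjoint phi : bounded phi -> bounded (fun y => adjoint (phi y)).
Proof.
by move=> [M phiM]; exists M => y _; apply: le_trans (norm_adjoint _) (phiM y I).
Qed.

Lemma bounded_opM phi chi : bounded phi -> bounded chi ->
  bounded (fun y => phi y * chi y).
Proof.
move=> [M phiM] [N chiN]; exists (M * N) => y _; rewrite rmorphM/=.
by apply: le_trans (op_normM _ _) _; rewrite ler_pM ?phiM ?chiN.
Qed.

Hypothesis m_state : is_state m.

Lemma inner_op_mean phi u v : bounded phi ->
  inner (op_mean phi u) v = state_at m (fun y => inner (phi y u) v).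
Proof.
move=> bphi; rewrite /op_mean; case: xgetP => [S _ //|/= noS].
suff [S SE] : exists S : bop H, forall u v,
    inner (S u) v = state_at m (fun y => inner (phi y u) v).
  by have := noS S SE.
have [M phiM] := bphi.
have M0 : 0 <= M by rewrite -lecR; apply: le_trans (phiM 1%g I).
apply: (@sesquilinear_bop _ _ _ M) => //.
- move=> w a x y; rewrite /= -state_at_lincomb//; try exact: bounded_inner.
  by congr state_at; apply/funext => z; rewrite linearP innerDl innerZl.
- move=> w a x y; rewrite /= -state_at_lincomb//; try exact: bounded_inner.
  by congr state_at; apply/funext => z; rewrite innerDr innerZr.
- move=> x y; apply: state_at_norm => // z.
  apply: le_trans (norm_inner _ _) _; rewrite ler_wpM2r//.
  apply: le_trans (op_norm_ub _ _) _; rewrite ler_wpM2r//; exact: phiM.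
Qed.

Lemma op_mean_unique phi (S : bop H) : bounded phi ->
  (forall u v, inner (S u) v = state_at m (fun y => inner (phi y u) v)) ->
  op_mean phi = S.
Proof.
by move=> bphi SE; apply: bop_inner_ext => u v; rewrite inner_op_mean.
Qed.

Lemma op_mean_norm phi (M : C) : (forall y, `|phi y| <= M) -> `|op_mean phi| <= M.
Proof.
move=> phiM; have M0 : 0 <= M by apply: le_trans (phiM 1%g).
have bphi : bounded phi.
  by exists (complex.Re M) => y _; rewrite RRe_real ?phiM ?ger0_real.
apply: op_norm_le => // u.
have [->|Tu0] := eqVneq (op_mean phi u) 0; first by rewrite normr0 mulr_ge0.
rewrite -(@ler_pM2r _ `|op_mean phi u|) ?normr_gt0// -expr2 normE_inner.
rewrite -[leLHS]ger0_norm ?inner_ge0// inner_op_mean//.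
apply: state_at_norm => // y.
apply: le_trans (norm_inner _ _) _; rewrite ler_wpM2r//.
by apply: le_trans (op_norm_ub _ _) _; rewrite ler_wpM2r.
Qed.

Definition correlation phi (x : G) : bop H :=
  op_mean (fun y => phi (x * y)%g * adjoint (phi y)).

Lemma bounded_correlation phi (x z : G) : bounded phi ->
  bounded (fun y => phi (x * y)%g * adjoint (phi (z * y)%g)).
Proof.
move=> bphi; apply: bounded_opM.
  exact: (bounded_op_comp (fun y => x * y)%g).
apply: (bounded_op_comp (fun y => z * y)%g (bounded_adjoint bphi)).
Qed.

Hypothesis m_inv : forall x (f : linfty G C^o), m (left_translate x f) = m f.

(** Replacing y by x_j^-1 y, the (i, j) entry becomes the mean of the inner
product of phi(x_j^-1 y)^adj v_j with phi(x_i^-1 y)^adj v_i, so the double sum is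
the mean of the square norm of one vector. *)
Lemma correlation_posdef phi : bounded phi -> positive_definite (correlation phi).
Proof.
move=> bphi n x _ v.
have E i j : inner (correlation phi ((x i)^-1 * x j)%g (v j)) (v i) =
    state_at m (fun y => inner (adjoint (phi ((x j)^-1 * y)%g) (v j))
                               (adjoint (phi ((x i)^-1 * y)%g) (v i))).
  rewrite inner_op_mean; last first.
    have := bounded_correlation ((x i)^-1 * x j)%g 1%g bphi.
    by congr (bounded_on _ _); apply/funext => y; rewrite mul1g.
  rewrite -(state_at_translate m_inv (x j)^-1); last first.
    apply: bounded_inner.
    have := bounded_correlation ((x i)^-1 * x j)%g 1%g bphi.
    by congr (bounded_on _ _); apply/funext => y; rewrite mul1g.
  congr state_at; apply/funext => y.
  by rewrite -mulgA mulVKg /= inner_adjoint.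
under eq_bigr do under eq_bigr do rewrite E.
have b i j : @bounded_on R G C^o setT
   (fun y => inner (adjoint (phi ((x j)^-1 * y)%g) (v j))
                   (adjoint (phi ((x i)^-1 * y)%g) (v i))).
  have := bounded_inner (v j) (v i) (bounded_correlation (x i)^-1 (x j)^-1 bphi).
  by congr (bounded_on _ _); apply/funext => y; rewrite /= inner_adjoint.
under eq_bigr do rewrite -state_at_sum//.
rewrite -state_at_sum//; last by move=> i; exact: bounded_on_sum.
apply: state_at_ge0 => //.
  by apply: bounded_on_sum => i; exact: bounded_on_sum.
move=> y; set w := \sum_i (adjoint (phi ((x i)^-1 * y)%g) (v i)).
have -> : \sum_i \sum_j inner (adjoint (phi ((x j)^-1 * y)%g) (v j))
                   (adjoint (phi ((x i)^-1 * y)%g) (v i)) = inner w w.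
  rewrite {2}/w linear_sumr; apply: eq_bigr => i _.
  by rewrite /w linear_sumlz.
exact: inner_ge0.
Qed.

End operator_means.

(** * From an invariant mean to a form *)
Section mean_form.
Variables (R : realType) (G : groupType) (H : hilbertType R).
Local Notation C := R[i].
Variable m : {scalar linfty G C^o}.
Hypothesis m_state : is_state m.
Implicit Types phi chi : linfty G (bop H).

(** The adjoint stands on the right: the values of this form at translates
are the correlations of phi, whereas the mean of phi(y)^adj chi(y) would not
give Gram matrices. *)
Definition mean_form phi chi : bop H :=
  op_mean m (fun y => chi y * adjoint (phi y)).

Let bounded_mean_form phi chi :
  @bounded_on R G (bop H) setT (fun y => chi y * adjoint (phi y)).
Proof.
by apply: bounded_opM; [|apply: bounded_adjoint]; exact: bounded_linfty.
Qed.

Let mean_formE phi chi u v : inner (mean_form phi chi u) v =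
  state_at m (fun y => inner (adjoint (phi y) u) (adjoint (chi y) v)).
Proof.
rewrite inner_op_mean//.
by congr state_at; apply/funext => y; rewrite /= inner_adjoint.
Qed.

Let bounded_mean_formE phi chi u v : @bounded_on R G C^o setT
  (fun y => inner (adjoint (phi y) u) (adjoint (chi y) v)).
Proof.
have := bounded_inner u v (bounded_mean_form phi chi).
by congr (bounded_on _ _); apply/funext => y; rewrite /= inner_adjoint.
Qed.

Lemma mean_formPl a phi phi' chi :
  mean_form (a *: phi + phi') chi = Num.conj a *: mean_form phi chi + mean_form phi' chi.
Proof.
apply: bop_inner_ext => u v; rewrite /= innerDl innerZl !mean_formE.
rewrite -state_at_lincomb//; congr state_at; apply/funext => y.
by rewrite adjointD adjointZ /= innerDl innerZl.
Qed.

Lemma mean_formPr a phi chi chi' :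
  mean_form phi (a *: chi + chi') = a *: mean_form phi chi + mean_form phi chi'.
Proof.
apply: bop_inner_ext => u v; rewrite /= innerDl innerZl !mean_formE.
rewrite -state_at_lincomb//; congr state_at; apply/funext => y.
by rewrite adjointD adjointZ /= innerDr innerZr conjCK.
Qed.

Let formDl chi : zmod_morphism (mean_form^~ chi).
Proof.
by move=> x y; rewrite addrC -scaleN1r mean_formPl rmorphN1 scaleN1r addrC.
Qed.

Let formDr phi : zmod_morphism (mean_form phi).
Proof.
by move=> x y; rewrite addrC -scaleN1r mean_formPr scaleN1r addrC.
Qed.

Let form0l chi : mean_form 0 chi = 0.
Proof. by rewrite -(subrr 0) formDl subrr. Qed.

Let form0r phi : mean_form phi 0 = 0.
Proof. by rewrite -(subrr 0) formDr subrr. Qed.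

Let formZl chi : scalable_for (Num.conj \; *:%R) (mean_form^~ chi).
Proof. by move=> a x; rewrite -[a *: x]addr0 mean_formPl form0l addr0. Qed.

Let formZr phi : scalable_for *:%R (mean_form phi).
Proof. by move=> a x; rewrite -[a *: x]addr0 mean_formPr form0r addr0. Qed.

Definition mean_bilinear :
    {bilinear linfty G (bop H) -> linfty G (bop H) -> bop H
       | Num.conj \; *:%R & *:%R} :=
  HB.pack mean_form
    (isBilinear.Build _ _ _ _ _ _ mean_form formDl formDr formZl formZr).

Lemma mean_form_ge0 phi : positive_op (mean_form phi phi).
Proof.
move=> v; rewrite mean_formE; apply: state_at_ge0 => // y; exact: inner_ge0.
Qed.

Lemma mean_form11 : mean_form (linfty_cst G (1 : bop H)) (linfty_cst G (1 : bop H)) = 1.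
Proof.
apply: op_mean_unique => [//||u v]; first exact: bounded_mean_form.
rewrite /= (_ : adjoint 1 = 1) ?mulr1 ?state_at_cst//.
by apply: adjoint_unique.
Qed.

Lemma norm_mean_form phi : `|mean_form phi phi| <= `|phi| ^+ 2.
Proof.
apply: op_mean_norm => // y; apply: le_trans (op_normM _ _) _.
rewrite expr2 ler_pM ?linfty_norm_ub//.
by apply: le_trans (norm_adjoint _) _; exact: linfty_norm_ub.
Qed.

Hypothesis m_inv : forall x (f : linfty G C^o), m (left_translate x f) = m f.

Lemma mean_form_translate phi x :
  mean_form (left_translate x phi) phi = correlation m phi x.
Proof.
have bphi := bounded_linfty phi.
apply: op_mean_unique => [//||u v]; first exact: bounded_mean_form.
have b := bounded_correlation x 1%g bphi.
rewrite inner_op_mean//; last first.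
  by congr (bounded_on _ _): b; apply/funext => y; rewrite mul1g.
rewrite -[RHS](state_at_translate m_inv x).
  by congr state_at; apply/funext => y /=; rewrite mulKg.
apply: bounded_inner; exact: bounded_mean_form.
Qed.

End mean_form.

(** The constant kappa = 1 works because a state has norm 1. *)
Lemma amenable_form (R : realType) (G : groupType) (H : hilbertType R)
    (H_neq0 : exists v : H, v != 0) : amenable R G ->
   exists (form : {bilinear linfty G (bop H) -> linfty G (bop H) -> bop H
                    | Num.conj \; *:%R & *:%R})
          (kappa : R),
     [/\ forall phi : linfty G (bop H), positive_op (form phi phi),
         0 < kappa,
         form (linfty_cst G (1 : bop H)) (linfty_cst G (1 : bop H)) <> 0,
         forall phi : linfty G (bop H), `|form phi phi| <= kappa%:C * `|phi| ^+ 2 &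
         forall phi, positive_definite (fun x => form (left_translate x phi) phi)].
Proof.
move=> [m [m_state m_inv]]; exists (mean_bilinear H m_state), 1; split => //.
- exact: mean_form_ge0.
- rewrite /= (mean_form11 _ m_state) => /(congr1 (fun T : bop H => T : H -> H)) E.
  have [v /eqP] := H_neq0; apply.
  by have := congr1 (@^~ v) E.
- by move=> phi; rewrite mul1r; exact: norm_mean_form.
- move=> phi.
  have -> : (fun x => mean_bilinear H m_state (left_translate x phi) phi) =
      correlation m phi by apply/funext => x; exact: mean_form_translate.
  apply: correlation_posdef => //; exact: bounded_linfty.
Qed.

(** * Series of vector functionals and ultraweak continuity *)
Section complex_series.
Variable R : realType.
Local Notation C := R[i].

Lemma norm_complex_le (z : C) :
  `|z| <= (`|complex.Re z| + `|complex.Im z|)%:C.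
Proof.
rewrite {1}(complexE z) rmorphD/=; apply: le_trans (ler_normD _ _) _.
by rewrite normrM complexiE normCi mul1r !normc_def /= !expr0n !addr0 !sqrtr_sqr.
Qed.

Lemma Im_norm_le (z : C) : `|complex.Im z|%:C <= `|z|.
Proof.
by rewrite normc_def lecR -sqrtr_sqr ler_wsqrtr// lerDr sqr_ge0.
Qed.

Lemma Re_sum (I : Type) (r : seq I) (c : I -> C) :
  complex.Re (\sum_(i <- r) c i) = \sum_(i <- r) complex.Re (c i).
Proof.
elim: r => [|i r ihr]; first by rewrite !big_nil.
by rewrite !big_cons -ihr; case: (c i) (\sum_(_ <- _) _) => [? ?] [? ?].
Qed.

Lemma Im_sum (I : Type) (r : seq I) (c : I -> C) :
  complex.Im (\sum_(i <- r) c i) = \sum_(i <- r) complex.Im (c i).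
Proof.
elim: r => [|i r ihr]; first by rewrite !big_nil.
by rewrite !big_cons -ihr; case: (c i) (\sum_(_ <- _) _) => [? ?] [? ?].
Qed.

Variables (c : nat -> C) (b : nat -> R).
Hypothesis b_ge0 : forall n, 0 <= b n.
Hypothesis cb : forall n, `|c n| <= (b n)%:C.
Hypothesis b_cvg : cvgn (series b).

(** The real and imaginary parts are absolutely convergent real series. *)
Lemma dominated_series_cvg : cvgn (series (c : nat -> C^o)).
Proof.
have part_cvg (p : C -> R) : (forall z, `|p z|%:C <= `|z|) ->
    cvgn (series (fun n => p (c n))).
  move=> pz; apply: (@normed_cvg R R^o).
  apply: series_le_cvg b_cvg => //= n.
  by rewrite -lecR; exact: le_trans (pz _) (cb n).
have /cvg_ex[r hr] := part_cvg _ (@normc_ge_Re R).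
have /cvg_ex[s hs] := part_cvg _ Im_norm_le.
apply/cvg_ex; exists (r +i* s : C^o); apply/cvgrPdist_le => e e0.
have /complex_realP[t tE] := gtr0_real e0.
have t0 : 0 < t / 2 by rewrite divr_gt0//; move: e0; rewrite tE ltr0c.
move/cvgrPdist_le : hr => /(_ _ t0) hr; move/cvgrPdist_le : hs => /(_ _ t0) hs.
near=> n; apply: le_trans (norm_complex_le _) _.
rewrite tE lecR (splitr t) lerD//.
  have -> : complex.Re ((r +i* s : C^o) - series (c : nat -> C^o) n) =
    r - series (fun n => complex.Re (c n)) n.
    by rewrite /series/= -Re_sum; case: (\sum_(_ <= _ < _) _).
  by near: n.
have -> : complex.Im ((r +i* s : C^o) - series (c : nat -> C^o) n) =
  s - series (fun n => complex.Im (c n)) n.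
  by rewrite /series/= -Im_sum; case: (\sum_(_ <= _ < _) _).
by near: n.
Unshelve. all: by end_near. Qed.

Lemma dominated_series_tail N :
  `|limn (series (c : nat -> C^o)) - series c N| <=
  (limn (series b) - series b N)%:C.
Proof.
set L := limn _; set S := series c N.
have : `|L - S| = (complex.Re `|L - S|)%:C by rewrite RRe_real// normr_real.
move=> normE; rewrite normE lecR; apply/ler_addgt0Pr => e e0.
rewrite -lecR -normE.
have eC : 0 < e%:C by rewrite ltr0c.
have /cvgrPdist_le/(_ _ eC) Le := dominated_series_cvg.
near \oo => n.
have Nn : (N <= n)%N by near: n; exact: nbhs_infty_ge.
have -> : L - S = (series c n - S) + (L - series c n) by ring.
apply: le_trans (ler_normD _ _) _; rewrite rmorphD lerD//; last by near: n.
rewrite sub_series_geq//; apply: le_trans (ler_norm_sum _ _ _) _.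
apply: (@le_trans _ _ (series b n - series b N)%:C).
  by rewrite sub_series_geq// rmorph_sum; apply: ler_sum => i _; exact: cb.
rewrite lecR lerD2r; apply: nondecreasing_cvgn_le => //.
exact: nondecreasing_series.
Unshelve. all: by end_near. Qed.

End complex_series.

Section ultraweak.
Variables (R : realType) (H : hilbertType R).
Local Notation C := R[i].
Implicit Types (S T : bop H) (xi eta : nat -> H).

(** The partial sums are real, nondecreasing, and eventually within 1 of the
complex limit, hence bounded. *)
Lemma square_summable_cvg xi : square_summable xi ->
  cvgn (series (fun n => complex.Re (`|xi n| ^+ 2))).
Proof.
have sq n : (complex.Re (`|xi n| ^+ 2))%:C = `|xi n| ^+ 2.
  by rewrite RRe_real// ger0_real// exprn_ge0.
have xi0 n : 0 <= complex.Re (`|xi n| ^+ 2).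
  by rewrite -lecR sq exprn_ge0.
have mono : nondecreasing_seq (series (fun n => complex.Re (`|xi n| ^+ 2))).
  exact: nondecreasing_series.
move=> /cvg_ex[l /cvgrPdist_le/(_ 1 ltr01)[N _ Nl]].
apply: nondecreasing_is_cvgn; first exact: mono.
have /complex_realP[nl lE] := normr_real l.
exists (nl + 1) => _ [n _ <-].
apply: (le_trans (mono _ _ (leq_maxr N n))).
have := Nl _ (leq_maxl N n); set k := maxn N n => lk.
rewrite -lecR rmorphD/= -lE.
have -> : (series (fun n => complex.Re (`|xi n| ^+ 2)) k)%:C =
    series (fun n => `|xi n| ^+ 2 : C^o) k.
  by rewrite /series rmorph_sum; apply: eq_bigr => i _; exact: sq.
rewrite -[leLHS]ger0_norm; last by apply: sumr_ge0 => i _; exact: exprn_ge0.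
by rewrite -[X in `|X|](subrK l) addrC (le_trans (ler_normD _ _))// lerD2l distrC.
Qed.

(** The tails are bounded by the norm of T times a null sequence that does not
depend on T.  Every property of [vector_series] used below is deduced from this
uniformity and from the same property of the finite sums. *)
Lemma vector_series_approx xi eta :
  square_summable xi -> square_summable eta ->
  exists r : nat -> R, [/\ forall N, 0 <= r N,
    forall e, 0 < e -> exists N, r N <= e &
    forall T N, `|vector_series xi eta T -
       \sum_(0 <= n < N) inner (T (xi n)) (eta n)| <= `|T| * (r N)%:C].
Proof.
move=> /square_summable_cvg xi2 /square_summable_cvg eta2.
pose b n := complex.Re (`|xi n| ^+ 2) + complex.Re (`|eta n| ^+ 2).
have bE n : (b n)%:C = `|xi n| ^+ 2 + `|eta n| ^+ 2.
  by rewrite /b rmorphD/= !RRe_real// realX// normr_real.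
have b0 n : 0 <= b n by rewrite -lecR bE addr_ge0// exprn_ge0.
have bcvg : cvgn (series b).
  have -> : series b = series (fun n => complex.Re (`|xi n| ^+ 2)) +
                       series (fun n => complex.Re (`|eta n| ^+ 2)).
    by apply/funext => n; exact: big_split.
  exact: is_cvgD.
have cb T n : `|inner (T (xi n)) (eta n)| <= (complex.Re `|T| * b n)%:C.
  rewrite real_complexM Re_normE bE; apply: le_trans (norm_inner _ _) _.
  apply: (@le_trans _ _ (`|T| * `|xi n| * `|eta n|)).
    by rewrite ler_wpM2r// op_norm_ub.
  rewrite -mulrA ler_wpM2l//.
  have h : `|xi n| ^+ 2 + `|eta n| ^+ 2 - `|xi n| * `|eta n| =
    (`|xi n| - `|eta n|) ^+ 2 + `|xi n| * `|eta n| by ring.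
  rewrite -subr_ge0 h addr_ge0//; last exact: mulr_ge0.
  by rewrite real_exprn_even_ge0// realB ?normr_real.
have T0 T : 0 <= complex.Re `|T| by rewrite -lecR Re_normE; exact: normr_ge0.
exists (fun N => limn (series b) - series b N); split.
- move=> N; rewrite subr_ge0; apply: nondecreasing_cvgn_le => //.
  exact: nondecreasing_series.
- move=> e e0; have /cvgrPdist_le/(_ _ e0)[N _ Ne] := bcvg.
  by exists N; apply: le_trans (ler_norm _) _; apply: Ne => /=.
- move=> T N.
  have Tb0 n : 0 <= complex.Re `|T| * b n by rewrite mulr_ge0.
  set t := complex.Re `|T|.
  have tbE : series (fun n => t * b n) = (fun N => t * series b N).
    by apply/funext => k; rewrite /series/= mulr_sumr.
  have tblim : series (fun n => t * b n) @ \oo --> t * limn (series b).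
    by rewrite tbE; apply: cvgM bcvg; exact: cvg_cst.
  apply: le_trans (dominated_series_tail Tb0 (cb T) _ N) _.
    by apply/cvg_ex; exists (t * limn (series b)).
  rewrite (cvg_lim _ tblim)//.
  have -> : `|T| = t%:C by rewrite Re_normE.
  by rewrite -real_complexM lecR tbE mulrBr.
Qed.

(** The shape in which the tail estimates are exploited: a number dominated by
a fixed multiple of arbitrarily small terms vanishes. *)
Lemma eq0_vanishing (a K : C) (r : nat -> R) : 0 <= K ->
  (forall e, 0 < e -> exists N, r N <= e) ->
  (forall N, `|a| <= K * (r N)%:C) -> a = 0.
Proof.
move=> K0 r0 aK; apply: (eq0_small K0) => e e0.
have [N rN] := r0 _ e0; apply: le_trans (aK N) _.
by rewrite mulrC ler_wpM2r// lecR.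
Qed.

Section one_series.
Variables (xi eta : nat -> H).
Hypotheses (xi2 : square_summable xi) (eta2 : square_summable eta).

Lemma vector_series_linear : scalar (vector_series xi eta).
Proof.
have [r [_ r0 rP]] := vector_series_approx xi2 eta2.
move=> a T S; apply/eqP; rewrite -subr_eq0; apply/eqP.
apply: (@eq0_vanishing _ (`|a *: T + S| + (`|a| * `|T| + `|S|)) r) => //.
  by rewrite !addr_ge0 ?mulr_ge0.
move=> N; pose s T := \sum_(0 <= n < N) inner (T (xi n)) (eta n).
have sP : s (a *: T + S) = a * s T + s S.
  rewrite /s mulr_sumr -big_split/=; apply: eq_bigr => i _.
  by rewrite innerDl innerZl.
set v := vector_series xi eta.
have -> : v (a *: T + S) - (a * v T + v S) =
    (v (a *: T + S) - s (a *: T + S)) - (a * (v T - s T) + (v S - s S)).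
  by rewrite sP; ring.
apply: le_trans (ler_normB _ _) _; rewrite mulrDl lerD ?rP//.
apply: le_trans (ler_normD _ _) _; rewrite mulrDl lerD ?rP//.
by rewrite normrM -mulrA ler_wpM2l// rP.
Qed.

Lemma vector_series_bounded : exists K : R, forall T,
  `|vector_series xi eta T| <= `|T| * K%:C.
Proof.
have [r [_ _ rP]] := vector_series_approx xi2 eta2.
by exists (r 0%N) => T; have := rP T 0%N; rewrite big_geq// subr0.
Qed.

Lemma bounded_vector_series (G : groupType) (chi : G -> bop H) :
  bounded_on setT chi ->
  @bounded_on R G C^o setT (fun y => vector_series xi eta (chi y)).
Proof.
move=> [M chiM]; have [K vK] := vector_series_bounded.
exists (M * `|K|) => y _; apply: le_trans (vK _) _; rewrite rmorphM/=.
apply: (@le_trans _ _ (`|chi y| * `|K|%:C)).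
  by rewrite ler_wpM2l// lecR ler_norm.
by rewrite ler_wpM2r ?chiM// ler0c.
Qed.

(** The finite sums commute with the mean by linearity, and both sides differ
from them by at most M times the common tail bound. *)
Lemma vector_series_op_mean (G : groupType) (m : {scalar linfty G C^o})
    (chi : G -> bop H) : is_state m -> bounded_on setT chi ->
  vector_series xi eta (op_mean m chi) =
  state_at m (fun y => vector_series xi eta (chi y)).
Proof.
move=> m_state bchi; have [M chiM] := bchi.
have [r [r_ge0 r0 rP]] := vector_series_approx xi2 eta2.
apply/eqP; rewrite -subr_eq0; apply/eqP.
have M0 : 0 <= M%:C by apply: le_trans (chiM 1%g I).
apply: (@eq0_vanishing _ (M%:C + M%:C) r) => //; first by rewrite addr_ge0.
move=> N; pose s T := \sum_(0 <= n < N) inner (T (xi n)) (eta n).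
have rC : 0 <= (r N)%:C by rewrite ler0c.
have bs : @bounded_on R G C^o setT (fun y => s (chi y)).
  by apply: bounded_on_sum => n; exact: bounded_inner.
have bv := bounded_vector_series bchi.
have sE : s (op_mean m chi) = state_at m (fun y => s (chi y)).
  rewrite /s state_at_sum//; first by apply: eq_bigr => n _; rewrite inner_op_mean.
  by move=> n; exact: bounded_inner.
have -> : vector_series xi eta (op_mean m chi) -
    state_at m (fun y => vector_series xi eta (chi y)) =
    (vector_series xi eta (op_mean m chi) - s (op_mean m chi)) +
    ((-1) * state_at m (fun y => vector_series xi eta (chi y)) +
     state_at m (fun y => s (chi y))).
  by rewrite sE; ring.
apply: le_trans (ler_normD _ _) _; rewrite mulrDl lerD//.
  apply: le_trans (rP _ _) _; rewrite ler_wpM2r//.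
  by apply: op_mean_norm => // y; exact: chiM.
rewrite -state_at_lincomb//; apply: state_at_norm => // y.
rewrite mulN1r addrC distrC; apply: le_trans (rP _ _) _.
by rewrite ler_wpM2r// chiM.
Qed.

End one_series.

(** Induction on the number of functionals.  If some x0 is killed by all but
the first functional, which takes the value 1 there, then
Phi - Phi(x0) g_0 vanishes on the common kernel of the others; if there is no
such x0, the first functional vanishes on that common kernel and can be
dropped. *)
Lemma kernel_span (V : lmodType C) n (g : 'I_n -> V -> C) (Phi : V -> C) :
  (forall k, scalar (g k)) -> scalar Phi ->
  (forall x, (forall k, g k x = 0) -> Phi x = 0) ->
  exists c : 'I_n -> C, forall x, Phi x = \sum_k c k * g k x.
Proof.
elim: n g Phi => [|n ihn] g Phi gl Phil ker.
  by exists (fun=> 0) => x; rewrite big_ord0 ker// => -[].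
pose g' (k : 'I_n) := g (lift ord0 k).
have g'l k : scalar (g' k) by exact: gl.
have [[x0 [g'0 g01]]|nox0] :=
    pselect (exists x0, (forall k, g' k x0 = 0) /\ g ord0 x0 = 1).
  pose Psi x := Phi x - Phi x0 * g ord0 x.
  have Psil : scalar Psi.
    by move=> a z x; rewrite /Psi Phil gl/=; ring.
  have [x x0'|c cE] := ihn g' Psi g'l Psil.
    have -> : Psi x = Phi (- g ord0 x *: x0 + x) by rewrite Phil /Psi; ring.
    apply: ker => k; rewrite gl; case: (unliftP ord0 k) => [j ->|->].
      by rewrite -!/(g' j) g'0 x0' mulr0 addr0.
    by rewrite g01 mulr1 addNr.
  exists (fun k => if unlift ord0 k is Some j then c j else Phi x0) => x.
  rewrite big_ord_recl unlift_none.
  under eq_bigr do rewrite liftK.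
  by rewrite -/(\sum_(i < n) c i * g' i x) -cE /Psi; ring.
have [x g'x|c cE] := ihn g' Phi g'l Phil.
  apply: ker => k; case: (unliftP ord0 k) => [j ->|->]; first exact: g'x.
  apply: contrapT => /eqP gx; apply: nox0; exists ((g ord0 x)^-1 *: x).
  have sc (f : V -> C) (a : C) : scalar f -> f (a *: x) = a * f x.
    move=> fl; have f0 : f 0 = 0.
      by have := fl (-1) 0 0; rewrite scaler0 addr0 mulN1r addNr.
    by have := fl a x 0; rewrite f0 !addr0.
  split=> [k'|]; first by rewrite sc// g'x mulr0.
  by rewrite sc// mulVf.
exists (fun k => if unlift ord0 k is Some j then c j else 0) => x.
rewrite big_ord_recl unlift_none mul0r add0r.
by under eq_bigr do rewrite liftK.
Qed.

(** Continuity at 0 bounds |Phi| by 1 where finitely many seminorms are small;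
on their common kernel T can be rescaled freely, so Phi vanishes there. *)
Lemma ultraweak_span (Phi : {scalar bop H}) : ultraweakly_continuous Phi ->
  exists (n : nat) (xi eta : 'I_n -> nat -> H) (c : 'I_n -> C),
    (forall k, square_summable (xi k) /\ square_summable (eta k)) /\
    forall T, Phi T = \sum_k c k * vector_series (xi k) (eta k) T.
Proof.
move=> /(_ 0 1 ltr01)[n [xi [eta [d [d0 sq dP]]]]].
have gl k := vector_series_linear (sq k).1 (sq k).2.
have [||T g0|c cE] := @kernel_span _ _
    (fun k => vector_series (xi k) (eta k)) Phi; last by exists n, xi, eta, c.
- exact: gl.
- exact: linearP.
apply: (@eq0_small _ _ 1) => // e e0; rewrite mulr1.
have eC : 0 < e^-1%:C by rewrite ltr0c invr_gt0.
have eC' : 0 < e%:C by rewrite ltr0c.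
have := dP (e^-1%:C *: T); rewrite (linear0 Phi) !subr0 linearZ/= normrM gtr0_norm//.
move=> h; apply: ltW; rewrite -[ltRHS]mulr1 -ltr_pdivrMl// -fmorphV; apply: h.
move=> k; have v0 : vector_series (xi k) (eta k) 0 = 0.
  by have := gl k (-1) 0 0; rewrite scaler0 addr0 mulN1r addNr.
have := gl k (e^-1%:C) T 0; rewrite addr0 g0 v0 mulr0 addr0 => ->.
by rewrite normr0 ltr0c.
Qed.

Lemma ultraweak_op_mean (G : groupType) (m : {scalar linfty G C^o})
    (chi : G -> bop H) (Phi : {scalar bop H}) :
  is_state m -> bounded_on setT chi -> ultraweakly_continuous Phi ->
  Phi (op_mean m chi) = state_at m (fun y => Phi (chi y)).
Proof.
move=> m_state bchi /ultraweak_span[n [xi [eta [c [sq PhiE]]]]].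
have bv k := bounded_vector_series (sq k).1 (sq k).2 bchi.
have b0 : @bounded_on R G C^o setT (fun=> (0 : C)) by exact: (@bounded_on_cst R G 0).
have bk k : @bounded_on R G C^o setT
    (fun y => c k * vector_series (xi k) (eta k) (chi y)).
  have := bounded_on_lincomb (c k) (bv k) b0.
  by congr (bounded_on _ _); apply/funext => y; rewrite addr0.
rewrite PhiE; transitivity (state_at m
    (fun y => \sum_k c k * vector_series (xi k) (eta k) (chi y))); last first.
  by congr state_at; apply/funext => y; rewrite PhiE.
rewrite state_at_sum//; apply: eq_bigr => k _.
have [xi2 eta2] := sq k; rewrite vector_series_op_mean//.
have := state_at_lincomb m (c k) (bv k) b0; rewrite state_at_cst// addr0 => <-.
by congr state_at; apply/funext => y; rewrite addr0.
Qed.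

End ultraweak.

Section vector_functional.
Variables (R : realType) (H : hilbertType R) (v : H).
Local Notation C := R[i].

Definition vector_functional (T : bop H) : C := inner (T v) v.

Fact vector_functional_linear : scalar vector_functional.
Proof. by move=> a S T; rewrite /vector_functional innerDl innerZl. Qed.

HB.instance Definition _ := GRing.isLinear.Build C (bop H) C *%R
  vector_functional vector_functional_linear.

(** The vector functional T |-> <T v, v> is the series attached to the sequence
v, 0, 0, ... taken twice. *)
Definition single_vector (n : nat) : H := if n is 0%N then v else 0.

Lemma series_single (c : nat -> C) : (forall n, c n.+1 = 0) ->
  series (c : nat -> C^o) @ \oo --> (c 0%N : C^o).
Proof.
move=> c0; apply: cvg_near_cst; exists 1%N => // -[//|n] _.
by rewrite /series/= big_nat_recl// big1 ?addr0.
Qed.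

Lemma single_vector_summable : square_summable single_vector.
Proof.
apply/cvg_ex; exists (`|v| ^+ 2 : C^o); apply: series_single => n.
by rewrite normr0 expr0n.
Qed.

Lemma vector_series_single T :
  vector_series single_vector single_vector T = vector_functional T.
Proof.
rewrite /vector_series.
have h : forall n, inner (T (single_vector n.+1)) (single_vector n.+1) = 0.
  by move=> n; exact: linear0r.
exact: (cvg_lim (@norm_hausdorff _ C^o) (series_single h)).
Qed.

Lemma vector_functional_ultraweak : ultraweakly_continuous vector_functional.
Proof.
move=> T0 e e0; exists 1%N, (fun=> single_vector), (fun=> single_vector), e.
split=> // [k|T h]; first by split; exact: single_vector_summable.
by have := h ord0; rewrite vector_series_single linearB.
Qed.

End vector_functional.

(** * Hermitian symmetry of positive definite maps *)
Section positive_definite.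
Variables (R : realType) (G : groupType) (H : hilbertType R).
Local Notation C := R[i].

(** Positivity for the points 1 and x and the vectors v and a v, with a = 1 and
a = - i, makes the combinations of [conj_of_real] real.  The case x = 1 is apart
because the points must be distinct. *)
Lemma posdef_conj (psi : G -> bop H) x v : positive_definite psi ->
  inner (psi x^-1%g v) v = Num.conj (inner (psi x v) v).
Proof.
move=> psi_pd.
have psi1 : inner (psi 1%g v) v \is Num.real.
  have := psi_pd 1%N (fun=> 1%g) _ (fun=> v).
  rewrite !big_ord1 mulVg => h; apply: ger0_real; apply: h.
  by move=> i j _; rewrite !ord1.
have [->|x1] := eqVneq x 1%g; first by rewrite invg1 (CrealP psi1).
pose p (i : 'I_2) : G := if i == ord0 then 1%g else x.
have p_inj : injective p.
  move=> i j; rewrite /p; case: eqP => [->|i0]; case: eqP => [->|j0]//.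
  - by move=> e; rewrite -e eqxx in x1.
  - by move=> e; rewrite e eqxx in x1.
  - move=> _; apply/val_inj; move: i0 j0.
    case: i => -[|[|i]] // hi; case: j => -[|[|j]] // hj i0 j0 //.
      by case: i0; apply/val_inj.
    by case: j0; apply/val_inj.
have key a : inner (psi 1%g v) v + a * inner (psi x v) v +
    (Num.conj a * inner (psi x^-1%g v) v +
      a * Num.conj a * inner (psi 1%g v) v) \is Num.real.
  have := psi_pd 2%N p p_inj (fun i => if i == ord0 then v else a *: v).
  rewrite !big_ord_recl !big_ord0 !addr0 /p /= !invg1 !mul1g !mulg1 !mulVg.
  have psiZ z : psi z (a *: v) = a *: psi z v by exact: linearZ.
  rewrite !psiZ !innerZl !innerZr mulrA => h; exact: ger0_real h.
apply: conj_of_real.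
  have := key 1; rewrite rmorph1 !mul1r => h.
  have -> : inner (psi x v) v + inner (psi x^-1%g v) v =
    inner (psi 1%g v) v + inner (psi x v) v +
      (inner (psi x^-1%g v) v + inner (psi 1%g v) v) -
      inner (psi 1%g v) v - inner (psi 1%g v) v by ring.
  by rewrite !realB.
have := key (- 'i); rewrite rmorphN/= conjCi opprK.
have -> : - 'i * 'i = 1 :> C by rewrite mulNr -expr2 sqrCi opprK.
rewrite mul1r => h.
have -> : 'i * (inner (psi x^-1%g v) v - inner (psi x v) v) =
    inner (psi 1%g v) v + - 'i * inner (psi x v) v +
      ('i * inner (psi x^-1%g v) v + inner (psi 1%g v) v) -
      inner (psi 1%g v) v - inner (psi 1%g v) v by ring.
by rewrite !realB.
Qed.

End positive_definite.

(** * From an invariant mean to a correlation state *)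
Section amenable_correlation.
Variables (R : realType) (G : groupType) (H : hilbertType R).
Local Notation C := R[i].

Definition correlation_property :=
  exists tau : {scalar linfty G C^o},
     is_state tau /\
     forall phi : linfty G (bop H), exists psi : G -> bop H,
       positive_definite psi /\
       forall (x : G) (Phi : {scalar bop H}), ultraweakly_continuous Phi ->
         Phi (adjoint (phi x) * psi x) =
         state_at tau
           (fun y => Phi (adjoint (phi x) * phi (x * y)%g * adjoint (phi y))).

Lemma amenable_correlation : amenable R G -> correlation_property.
Proof.
move=> [m [m_state m_inv]]; exists m; split=> // phi.
have bphi := bounded_linfty phi.
exists (correlation m phi); split; first exact: correlation_posdef.
move=> x Phi Phi_uw.
have bcor : bounded_on setT (fun y => phi (x * y)%g * adjoint (phi y)).
  have := bounded_correlation x 1%g bphi.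
  by congr (bounded_on _ _); apply/funext => y; rewrite mul1g.
have bprod : bounded_on setT
    (fun y => adjoint (phi x) * phi (x * y)%g * adjoint (phi y)).
  have := bounded_opM (bounded_linfty (linfty_cst G (adjoint (phi x)))) bcor.
  by congr (bounded_on _ _); apply/funext => y; rewrite /= mulrA.
rewrite -(ultraweak_op_mean m_state bprod Phi_uw); congr (Phi _).
apply/esym; apply: op_mean_unique => // u v.
rewrite /= inner_adjointl inner_op_mean//; congr state_at; apply/funext => y.
by rewrite /= inner_adjointl.
Qed.

End amenable_correlation.

(** * A correlation state is left-invariant *)
Section correlation_amenable.
Variables (R : realType) (G : groupType) (H : hilbertType R).
Local Notation C := R[i].
Local Notation bounded f := (@bounded_on R G C^o setT f).
Variable tau : {scalar linfty G C^o}.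
Hypothesis tau_state : is_state tau.
Hypothesis H_neq0 : exists v : H, v != 0.
Hypothesis tau_cor : forall phi : linfty G (bop H), exists psi : G -> bop H,
  positive_definite psi /\
  forall (x : G) (Phi : {scalar bop H}), ultraweakly_continuous Phi ->
    Phi (adjoint (phi x) * psi x) =
    state_at tau
      (fun y => Phi (adjoint (phi x) * phi (x * y)%g * adjoint (phi y))).
Implicit Types f g : G -> C.

(** For phi = f Id the defining identity of psi, read through T |-> <T v, v>,
contains the factor conj (f x) on both sides; as it is nonzero, psi(x) is a
multiple of the scalar correlation of f and [posdef_conj] applies to the
latter. *)
Lemma correlation_hermitian f x : bounded f -> (forall y, f y != 0) ->
  state_at tau (fun y => f (x^-1 * y)%g * Num.conj (f y)) =
  state_at tau (fun y => Num.conj (f (x * y)%g) * f y).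
Proof.
move=> bf f0; have [v v0] := H_neq0.
have phiP : (fun y => f y *: (1 : bop H)) \in @linfty_pred R G (bop H).
  rewrite inE; have [M fM] := bf; exists (M * complex.Re `|1 : bop H|) => y _.
  by rewrite real_complexM Re_normE normrZ ler_wpM2r// fM.
have [psi [psi_pd psiE]] := tau_cor (Linfty phiP).
have vv0 : inner v v != 0 by rewrite -normE_inner sqrf_eq0 normr_eq0.
have adj a : adjoint (a *: (1 : bop H)) = Num.conj a *: (1 : bop H).
  by apply: adjoint_unique => u w; rewrite /= innerZl innerZr conjCK.
have bcor z : bounded (fun y => f (z * y)%g * Num.conj (f y)).
  apply: bounded_onM (bounded_on_conj bf).
  exact: (bounded_on_comp (fun y => z * y)%g bf).
have psi_v z : inner (psi z v) v =
    inner v v * state_at tau (fun y => f (z * y)%g * Num.conj (f y)).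
  have := psiE z (vector_functional v) (vector_functional_ultraweak v).
  rewrite /= adj {1}/vector_functional /= innerZl => e.
  have fz0 : Num.conj (f z) != 0 by rewrite conjC_eq0.
  apply: (mulfI fz0); rewrite e mulrA -state_atZ//.
  congr state_at; apply/funext => y.
  by rewrite adj /vector_functional /= !innerZl; ring.
have := posdef_conj x v psi_pd; rewrite !psi_v rmorphM/= -state_at_conj//.
rewrite -inner_conj => /(mulfI vv0) ->.
by congr state_at; apply/funext => y; rewrite rmorphM/= conjCK.
Qed.

Lemma state_at_shift_prod (t : C) f g : bounded f -> bounded g ->
  state_at tau (fun y => (t + f y) * (t + g y)) =
  t * state_at tau f + (t * state_at tau g +
   (1 * state_at tau (fun y => f y * g y) + t * t)).
Proof.
move=> bf bg; have bc := @bounded_on_cst R G (t * t).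
have bfg := bounded_onM bf bg.
have b1 := bounded_on_lincomb 1 bfg bc.
rewrite -[X in _ + (_ + (_ + X))](state_at_cst tau_state (t * t)).
rewrite -!state_at_lincomb//; last exact: bounded_on_lincomb.
by congr state_at; apply/funext => y; ring.
Qed.

(** The function t + h has no zero when t exceeds the bound of h.  Expanding
[correlation_hermitian] for t + g and for t - g and subtracting, the terms
quadratic in g and the constant terms cancel. *)
Lemma correlation_polarized g x : bounded g ->
  state_at tau (fun y => g (x^-1 * y)%g) + state_at tau (fun y => Num.conj (g y)) =
  state_at tau g + state_at tau (fun y => Num.conj (g (x * y)%g)).
Proof.
move=> bg; have [M gM] := bg.
(* Any constant larger than the bound M of g will do. *)
pose t : C := (`|M| + 1)%:C.
have t0 : t != 0.
  by rewrite gt_eqF// ltr0c ltr_wpDl.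
have key (h : G -> C) : bounded h -> (forall y, `|h y| <= M%:C) ->
    t * state_at tau (fun y => h (x^-1 * y)%g) +
    (t * state_at tau (fun y => Num.conj (h y)) +
      state_at tau (fun y => h (x^-1 * y)%g * Num.conj (h y))) =
    t * state_at tau (fun y => Num.conj (h (x * y)%g)) +
    (t * state_at tau h +
      state_at tau (fun y => Num.conj (h (x * y)%g) * h y)).
  move=> bh hM.
  have bhx z : bounded (fun y => h (z * y)%g).
    exact: (bounded_on_comp (fun y => z * y)%g bh).
  have tc : Num.conj t = t by apply/CrealP; rewrite complex_real.
  have bth : bounded (fun y => t + h y).
    have := bounded_on_lincomb 1 bh (@bounded_on_cst R G t).
    by congr (bounded_on _ _); apply/funext => y; rewrite mul1r addrC.
  have hn0 y : t + h y != 0.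
    apply/negP; rewrite addr_eq0 => /eqP tE.
    have := hM y; rewrite -normrN -tE ger0_norm; last first.
      by rewrite /t ler0c addr_ge0.
    rewrite /t lecR.
    by apply/negP; rewrite -ltNge ltr_pwDr// ler_norm.
  have := correlation_hermitian x bth hn0.
  have -> : (fun y => (t + h (x^-1 * y)%g) * Num.conj (t + h y)) =
      (fun y => (t + h (x^-1 * y)%g) * (t + Num.conj (h y))).
    by apply/funext => y; rewrite rmorphD/= tc.
  have -> : (fun y => Num.conj (t + h (x * y)%g) * (t + h y)) =
      (fun y => (t + Num.conj (h (x * y)%g)) * (t + h y)).
    by apply/funext => y; rewrite rmorphD/= tc.
  rewrite !state_at_shift_prod//; try exact: bounded_on_conj.
  by rewrite !mul1r !addrA => /addIr.
have k1 := key g bg (fun y => gM y I).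
have bng := bounded_onZ (-1) bg.
have /key k2 : forall y, `|-1 * g y| <= M%:C.
  by move=> y; rewrite mulN1r normrN; exact: gM.
move: (k2 bng).
have bgx z : bounded (fun y => g (z * y)%g).
  exact: (bounded_on_comp (fun y => z * y)%g bg).
have -> : (fun y => Num.conj (-1 * g y)) = (fun y => -1 * Num.conj (g y)).
  by apply/funext => y; rewrite rmorphM rmorphN1.
have -> : (fun y => Num.conj (-1 * g (x * y)%g)) =
    (fun y => -1 * Num.conj (g (x * y)%g)).
  by apply/funext => y; rewrite rmorphM rmorphN1.
have -> : (fun y => -1 * g (x^-1 * y)%g * Num.conj (-1 * g y)) =
    (fun y => g (x^-1 * y)%g * Num.conj (g y)).
  by apply/funext => y; rewrite rmorphM rmorphN1/=; ring.
have -> : (fun y => Num.conj (-1 * g (x * y)%g) * (-1 * g y)) =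
    (fun y => Num.conj (g (x * y)%g) * g y).
  by apply/funext => y; rewrite rmorphM rmorphN1/=; ring.
rewrite !state_atZ//; try exact: bounded_on_conj.
move: k1; set a := state_at _ _; set b := state_at _ _; set c := state_at _ _.
set d := state_at _ _; set e := state_at _ _; set f := state_at _ _ => k1 k2'.
(* The identity for g minus the identity for - g. *)
have : (2 * t) * (a + b) = (2 * t) * (e + d).
  transitivity (t * a + (t * b + c) - (t * (-1 * a) + (t * (-1 * b) + c))).
    by ring.
  by rewrite k1 k2'; ring.
by move/mulfI; apply; rewrite mulf_neq0// pnatr_eq0.
Qed.

(** Applied to i g, [correlation_polarized] changes sign in its conjugated
terms; adding the two identities eliminates these. *)
Lemma correlation_amenable : amenable R G.
Proof.
exists tau; split=> // x g.
have bg : bounded (g : G -> C) by exact: linfty_bounded.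
have bgx z : bounded (fun y => g (z * y)%g).
  exact: (bounded_on_comp (fun y => z * y)%g bg).
rewrite -!state_at_val.
change (state_at tau (fun y => g (x^-1 * y)%g) = state_at tau g).
have k1 := correlation_polarized x bg.
have := correlation_polarized x (bounded_onZ 'i bg).
have -> : (fun y => Num.conj ('i * g y)) = (fun y => - 'i * Num.conj (g y)).
  by apply/funext => y; rewrite rmorphM/= conjCi.
have -> : (fun y => Num.conj ('i * g (x * y)%g)) =
    (fun y => - 'i * Num.conj (g (x * y)%g)).
  by apply/funext => y; rewrite rmorphM/= conjCi.
rewrite !state_atZ//; try exact: bounded_on_conj.
move: k1; set a := state_at _ _; set b := state_at _ _; set c := state_at _ _.
set d := state_at _ _ => k1 k2.
have : (2 * 'i) * a = (2 * 'i) * c.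
  transitivity ('i * (a + b) + ('i * a + - 'i * b)); first by ring.
  by rewrite k1 k2; ring.
by move/mulfI; apply; rewrite mulf_neq0 ?pnatr_eq0 ?neq0Ci.
Qed.

End correlation_amenable.

(** * The positive part of an invariant functional *)
Section positive_part.
Variables (R : realType) (G : groupType).
Local Notation C := R[i].
Implicit Types u w : G -> R.

Definition bounded_real u := exists M, forall y, `|u y| <= M.

Lemma bounded_real_lincomb a u w : bounded_real u -> bounded_real w ->
  bounded_real (fun y => a * u y + w y).
Proof.
move=> [M uM] [N wN]; exists (`|a| * M + N) => y.
apply: le_trans (ler_normD _ _) _; rewrite normrM lerD//.
by rewrite ler_wpM2l.
Qed.

Lemma bounded_real_cst a : bounded_real (fun=> a).
Proof. by exists `|a|. Qed.

Lemma bounded_realZ a u : bounded_real u -> bounded_real (fun y => a * u y).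
Proof.
move=> bu; have := bounded_real_lincomb a bu (bounded_real_cst 0).
by congr bounded_real; apply/funext => y; rewrite addr0.
Qed.

Lemma bounded_realD u w : bounded_real u -> bounded_real w ->
  bounded_real (fun y => u y + w y).
Proof.
move=> bu bw; have := bounded_real_lincomb 1 bu bw.
by congr bounded_real; apply/funext => y; rewrite mul1r.
Qed.

Lemma bounded_real_between u w : bounded_real u ->
  (forall y, 0 <= w y <= u y) -> bounded_real w.
Proof.
move=> [M uM] wu; exists M => y; have /andP[w0 wy] := wu y.
by rewrite ger0_norm//; apply: le_trans wy _; apply: le_trans (ler_norm _) _.
Qed.

Lemma bounded_real_shift u x : bounded_real u -> bounded_real (fun y => u (x * y)%g).
Proof. by move=> [M uM]; exists M. Qed.

Variable rho : (G -> R) -> R.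
Hypothesis rhoP : forall a u w, bounded_real u -> bounded_real w ->
  rho (fun y => a * u y + w y) = a * rho u + rho w.
Hypothesis rho_bounded : exists K : R, forall u (M : R), (forall y, `|u y| <= M) ->
  `|rho u| <= K * M.
Hypothesis rho_shift : forall x u, bounded_real u ->
  rho (fun y => u (x * y)%g) = rho u.
Hypothesis rho1 : 0 < rho (fun=> 1).

Let rho0 : rho (fun=> 0) = 0.
Proof.
have := rhoP (-1) (bounded_real_cst 0) (bounded_real_cst 0).
by rewrite mulr0 addr0 mulN1r addNr.
Qed.

Let rhoZ a u : bounded_real u -> rho (fun y => a * u y) = a * rho u.
Proof.
move=> bu; have := rhoP a bu (bounded_real_cst 0); rewrite rho0 addr0 => <-.
by congr rho; apply/funext => y; rewrite addr0.
Qed.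

Let rhoD u w : bounded_real u -> bounded_real w ->
  rho (fun y => u y + w y) = rho u + rho w.
Proof.
move=> bu bw; have := rhoP 1 bu bw; rewrite mul1r => <-.
by congr rho; apply/funext => y; rewrite mul1r.
Qed.

Let below u := [set w | forall y, 0 <= w y <= u y].

(** The value at u >= 0 of the positive part of rho in the sense of Riesz
spaces. *)
Definition upper_variation u : R := sup [set rho w | w in below u].

Let upper_variation_ub u w : bounded_real u -> below u w ->
  rho w <= upper_variation u.
Proof.
move=> [M uM] wu; apply: ub_le_sup; last by exists w.
have [K rhoK] := rho_bounded; exists (K * M) => _ [z zu <-].
apply: le_trans (ler_norm _) _; apply: rhoK => y.
have /andP[z0 zy] := zu y; rewrite ger0_norm//.
by apply: le_trans zy _; apply: le_trans (ler_norm _) _.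
Qed.

Let upper_variation_le u c : (forall y, 0 <= u y) ->
  (forall w, below u w -> rho w <= c) -> upper_variation u <= c.
Proof.
move=> u0 uc; apply: ge_sup; last by move=> _ [w wu <-]; exact: uc.
by exists (rho (fun=> 0)); exists (fun=> 0) => // y; rewrite lexx u0.
Qed.

Let upper_variation_ge0 u : bounded_real u -> (forall y, 0 <= u y) ->
  0 <= upper_variation u.
Proof.
move=> bu u0; rewrite -rho0; apply: upper_variation_ub => // y.
by rewrite lexx u0.
Qed.

(** Riesz decomposition: a function z with 0 <= z <= u + w is the sum of
min(z, u), which lies below u, and of z - min(z, u), which lies below w. *)
Let upper_variationD u w : bounded_real u -> bounded_real w ->
  (forall y, 0 <= u y) -> (forall y, 0 <= w y) ->
  upper_variation (fun y => u y + w y) = upper_variation u + upper_variation w.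
Proof.
move=> bu bw u0 w0; apply/eqP; rewrite eq_le; apply/andP; split.
  apply: upper_variation_le => [y|z zuw]; first exact: addr_ge0.
  (* Splitting z into a part below u and a part below w. *)
  pose z1 y := Num.min (z y) (u y); pose z2 y := z y - z1 y.
  have z1u : below u z1.
    move=> y; have /andP[z0 _] := zuw y.
    by rewrite /z1 le_min z0 u0 ge_min lexx orbT.
  have z2w : below w z2.
    move=> y; have /andP[z0 zy] := zuw y; rewrite /z2 /z1.
    rewrite subr_ge0 ge_min lexx/= lerBlDr.
    by rewrite minEle; case: ifP => _; rewrite ?lerDr// addrC.
  have -> : z = (fun y => z1 y + z2 y).
    by apply/funext => y; rewrite /z2; ring.
  rewrite rhoD; first by rewrite lerD// upper_variation_ub.
    exact: bounded_real_between bu z1u.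
  exact: bounded_real_between bw z2w.
rewrite -lerBrDr; apply: upper_variation_le => // z1 z1u.
rewrite lerBrDl -lerBrDr; apply: upper_variation_le => // z2 z2w.
rewrite lerBrDl -rhoD; last 2 first.
- exact: bounded_real_between z1u.
- exact: bounded_real_between z2w.
apply: upper_variation_ub; first exact: bounded_realD.
move=> y; have /andP[? ?] := z1u y; have /andP[? ?] := z2w y.
by rewrite addr_ge0// lerD.
Qed.

Let upper_variationZ_le c u : 0 < c -> bounded_real u -> (forall y, 0 <= u y) ->
  c * upper_variation u <= upper_variation (fun y => c * u y).
Proof.
move=> c0 bu u0; rewrite mulrC -ler_pdivlMr//; apply: upper_variation_le => // w wu.
rewrite ler_pdivlMr// mulrC -rhoZ; last exact: bounded_real_between wu.
apply: upper_variation_ub; first exact: bounded_realZ.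
move=> y; have /andP[w0 wy] := wu y.
by rewrite mulr_ge0 ?(ltW c0)// ler_pM2l.
Qed.

Let upper_variationZ c u : 0 <= c -> bounded_real u -> (forall y, 0 <= u y) ->
  upper_variation (fun y => c * u y) = c * upper_variation u.
Proof.
rewrite le_eqVlt => /predU1P[<-|c0] bu u0.
  have -> : (fun y => 0 * u y) = (fun y => 0) by apply/funext => y; rewrite mul0r.
  apply/eqP; rewrite mul0r eq_le upper_variation_ge0 ?andbT//;
    last exact: bounded_real_cst.
  apply: upper_variation_le => // w w0; rewrite -rho0 le_eqVlt; apply/orP; left.
  apply/eqP; congr rho; apply/funext => y; apply/eqP.
  by rewrite eq_le andbC; exact: w0.
apply/eqP; rewrite eq_le upper_variationZ_le// andbT.
rewrite -ler_pdivrMl//.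
apply: le_trans (upper_variationZ_le _ _ _) _.
- by rewrite invr_gt0.
- exact: bounded_realZ.
- by move=> y; rewrite mulr_ge0// ltW.
rewrite le_eqVlt; apply/orP; left; apply/eqP; congr upper_variation.
by apply/funext => y; rewrite mulrA mulVf ?mul1r// gt_eqF.
Qed.

Let upper_variation_shift x u : bounded_real u -> (forall y, 0 <= u y) ->
  upper_variation (fun y => u (x * y)%g) = upper_variation u.
Proof.
have le z w : bounded_real w -> (forall y, 0 <= w y) ->
    upper_variation w <= upper_variation (fun y => w (z * y)%g).
  move=> bw w0; apply: upper_variation_le => // r rw.
  rewrite -(rho_shift z); last exact: bounded_real_between rw.
  by apply: upper_variation_ub => [|y]; [exact: bounded_real_shift|exact: rw].
move=> bu u0; apply/eqP; rewrite eq_le le// andbT.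
apply: le_trans (le x^-1%g _ _ _) _; first exact: bounded_real_shift.
  by move=> y.
by under eq_fun do rewrite mulVKg.
Qed.

Let pos u y := Num.max (u y) 0.
Let neg u y := Num.max (- u y) 0.

Let bounded_pos u : bounded_real u -> bounded_real (pos u).
Proof.
move=> [M uM]; exists M => y; apply: le_trans (uM y); rewrite /pos.
by rewrite maxEle; case: ifP => // _; rewrite normr0.
Qed.

Let bounded_neg u : bounded_real u -> bounded_real (neg u).
Proof.
move=> [M uM]; exists M => y; apply: le_trans (uM y); rewrite /neg.
by rewrite maxEle; case: ifP => _; rewrite ?normr0 ?normrN.
Qed.

Let pos_ge0 u y : 0 <= pos u y. Proof. by rewrite le_max lexx orbT. Qed.
Let neg_ge0 u y : 0 <= neg u y. Proof. by rewrite le_max lexx orbT. Qed.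

Let pos_neg u y : u y = pos u y - neg u y.
Proof. by rewrite /pos /neg !maxEle; case: ifP; case: ifP; lra. Qed.

Let ext u := upper_variation (pos u) - upper_variation (neg u).

(** The extension to functions of arbitrary sign may be computed from any
decomposition u = a - b into nonnegative functions, because
pos u + b = neg u + a. *)
Let extE u a b : bounded_real a -> bounded_real b ->
  (forall y, 0 <= a y) -> (forall y, 0 <= b y) -> u = (fun y => a y - b y) ->
  ext u = upper_variation a - upper_variation b.
Proof.
move=> ba bb a0 b0 uE.
have bu : bounded_real u.
  rewrite uE; have := bounded_real_lincomb (-1) bb ba.
  by congr bounded_real; apply/funext => y; ring.
apply/eqP; rewrite subr_eq addrAC eq_sym subr_eq; apply/eqP.
have [bp bn] := (bounded_pos bu, bounded_neg bu).
rewrite -!upper_variationD//; congr upper_variation; apply/funext => y.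
by have := pos_neg u y; rewrite {1}uE; lra.
Qed.

Let extD u w : bounded_real u -> bounded_real w ->
  ext (fun y => u y + w y) = ext u + ext w.
Proof.
move=> bu bw; have [bpu bnu] := (bounded_pos bu, bounded_neg bu).
have [bpw bnw] := (bounded_pos bw, bounded_neg bw).
rewrite (@extE _ (fun y => pos u y + pos w y) (fun y => neg u y + neg w y)).
- by rewrite !upper_variationD// /ext; ring.
- exact: bounded_realD.
- exact: bounded_realD.
- by move=> y; rewrite addr_ge0.
- by move=> y; rewrite addr_ge0.
- by apply/funext => y; rewrite {1}(pos_neg u) {1}(pos_neg w); ring.
Qed.

Let extZ c u : bounded_real u -> ext (fun y => c * u y) = c * ext u.
Proof.
move=> bu; have [bpu bnu] := (bounded_pos bu, bounded_neg bu).
have [c0|c0] := leP 0 c.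
  rewrite (@extE _ (fun y => c * pos u y) (fun y => c * neg u y)).
  - by rewrite !upper_variationZ// /ext; ring.
  - exact: bounded_realZ.
  - exact: bounded_realZ.
  - by move=> y; rewrite mulr_ge0.
  - by move=> y; rewrite mulr_ge0.
  - by apply/funext => y; rewrite {1}(pos_neg u); ring.
have nc0 : 0 <= - c by rewrite oppr_ge0 ltW.
rewrite (@extE _ (fun y => - c * neg u y) (fun y => - c * pos u y)).
- by rewrite !upper_variationZ// /ext; ring.
- exact: bounded_realZ.
- exact: bounded_realZ.
- by move=> y; rewrite mulr_ge0.
- by move=> y; rewrite mulr_ge0.
- by apply/funext => y; rewrite {1}(pos_neg u); ring.
Qed.

Let ext_ge0 u : bounded_real u -> (forall y, 0 <= u y) ->
  ext u = upper_variation u.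
Proof.
move=> bu u0; have b0 := bounded_real_cst 0.
rewrite (@extE _ u (fun=> 0))//; last by apply/funext => y; rewrite subr0.
have -> : (fun=> 0) = (fun y => 0 * u y) :> (G -> R).
  by apply/funext => y; rewrite mul0r.
by rewrite upper_variationZ// mul0r subr0.
Qed.

Let ext_shift x u : bounded_real u -> ext (fun y => u (x * y)%g) = ext u.
Proof.
move=> bu; have [bpu bnu] := (bounded_pos bu, bounded_neg bu).
by rewrite /ext -(upper_variation_shift x bpu)// -(upper_variation_shift x bnu).
Qed.

Let ext1 : 0 < ext (fun=> 1).
Proof.
rewrite ext_ge0//; last exact: bounded_real_cst.
apply: lt_le_trans rho1 _; apply: upper_variation_ub => [|y].
  exact: bounded_real_cst.
by rewrite ler01 lexx.
Qed.

Let bounded_Re (f : linfty G C^o) : bounded_real (fun y => complex.Re (f y)).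
Proof.
have [M fM] := linfty_bounded f; exists M => y.
by rewrite -lecR; apply: le_trans (fM y I); exact: normc_ge_Re.
Qed.

Let bounded_Im (f : linfty G C^o) : bounded_real (fun y => complex.Im (f y)).
Proof.
have [M fM] := linfty_bounded f; exists M => y.
by rewrite -lecR; apply: le_trans (fM y I); exact: Im_norm_le.
Qed.

Let mean (f : linfty G C^o) : C :=
  (ext (fun y => complex.Re (f y)) / ext (fun=> 1)) +i*
  (ext (fun y => complex.Im (f y)) / ext (fun=> 1)).

Let mean_linear : scalar mean.
Proof.
move=> [a b] f g; rewrite /mean.
have [bfr bfi] := (bounded_Re f, bounded_Im f).
have [bgr bgi] := (bounded_Re g, bounded_Im g).
have -> : (fun y => complex.Re ((a +i* b *: f + g) y)) = (fun y =>
    (a * complex.Re (f y) + - b * complex.Im (f y)) + complex.Re (g y)).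
  apply/funext => y.
  change (complex.Re ((a +i* b) * f y + g y) =
    a * complex.Re (f y) + - b * complex.Im (f y) + complex.Re (g y)).
  by case: (f y) (g y) => [r s] [r' s'] /=; ring.
have -> : (fun y => complex.Im ((a +i* b *: f + g) y)) = (fun y =>
    (a * complex.Im (f y) + b * complex.Re (f y)) + complex.Im (g y)).
  apply/funext => y.
  change (complex.Im ((a +i* b) * f y + g y) =
    a * complex.Im (f y) + b * complex.Re (f y) + complex.Im (g y)).
  by case: (f y) (g y) => [r s] [r' s'] /=; ring.
have bz c u : bounded_real u -> bounded_real (fun y => c * u y).
  exact: bounded_realZ.
have bd u w : bounded_real u -> bounded_real w ->
    bounded_real (fun y => u y + w y) by exact: bounded_realD.
rewrite !(extD, extZ); try by [exact: bz|apply: bd; exact: bz|].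
apply/eqP; rewrite eq_complex /=; apply/andP; split; apply/eqP; ring.
Qed.

(** Invariance passes from rho to its positive part, and the latter is positive
at 1 because rho is, so it can be normalized. *)
Lemma amenable_of_shift_invariant : amenable R G.
Proof.
pose m : {scalar linfty G C^o} :=
  HB.pack mean (GRing.isLinear.Build _ _ _ _ _ mean_linear).
have inv0 : 0 <= (ext (fun=> 1))^-1 by rewrite invr_ge0 ltW.
have ext0 : ext (fun=> 0) = 0.
  by have := extZ 0 (bounded_real_cst 0); rewrite !mul0r.
exists m; split; [split=> [f f0|]|move=> x f].
- change (0 <= mean f).
  have fr y : complex.Im (f y) = 0 by exact: ger0_Im.
  rewrite /mean (_ : (fun y => complex.Im (f y)) = (fun=> 0)); last exact/funext.
  rewrite ext0 mul0r complexr0 ler0c mulr_ge0// ext_ge0//.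
    apply: upper_variation_ge0 => // y.
    by have := f0 y; rewrite lecE => /andP[_].
  by move=> y; have := f0 y; rewrite lecE => /andP[_].
- change (mean (linfty_cst G (1 : C^o)) = 1).
  by rewrite /mean /= ext0 mul0r complexr0 divff// gt_eqF.
- change (mean (left_translate x f) = mean f).
  rewrite /mean /=.
  by rewrite (ext_shift x^-1 (bounded_Re f)) (ext_shift x^-1 (bounded_Im f)).
Qed.

End positive_part.

(** * From a form to an invariant mean *)
Section form_amenable.
Variables (R : realType) (G : groupType) (H : hilbertType R).
Local Notation C := R[i].
Local Notation L := (linfty G (bop H)).

(** Polarization for operators; it yields a vector v at which the quadratic
form of the nonzero operator <1, 1> does not vanish. *)
Lemma bop_quadratic_eq0 (T : bop H) : (forall v, inner (T v) v = 0) -> T = 0.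
Proof.
move=> T0.
have Dl w : zmod_morphism (fun u => inner (T u) w).
  by move=> u u'; rewrite linearB innerBl.
have Dr u : zmod_morphism (inner (T u)) by move=> w w'; rewrite innerBr.
have Zl w : scalable_for *%R (fun u => inner (T u) w).
  by move=> a u; rewrite linearZ innerZl.
have Zr u : scalable_for (Num.conj \; *%R) (inner (T u)).
  by move=> a w; rewrite innerZr.
pose q : {bilinear H -> H -> C | *%R & Num.conj \; *%R} :=
  HB.pack (fun u w => inner (T u) w) (isBilinear.Build _ _ _ _ _ _ _ Dl Dr Zl Zr).
apply: bop_inner_ext => u w; rewrite (form_eq0 (f := q) T0 u w : inner (T u) w = 0).
by rewrite linear0l.
Qed.

Variable form : {bilinear L -> L -> bop H | Num.conj \; *:%R & *:%R}.
Variable kappa : R.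
Hypothesis form_ge0 : forall phi, positive_op (form phi phi).
Hypothesis form_bounded : forall phi, `|form phi phi| <= kappa%:C * `|phi| ^+ 2.
Hypothesis form_pd :
  forall phi, positive_definite (fun x => form (left_translate x phi) phi).

Section fixed_vector.
Variable v : H.

(** The arguments are exchanged so that the form is linear in the first
variable, like the inner product. *)
Definition scalar_form (chi phi : L) : C := inner (form phi chi v) v.

Lemma scalar_formBl phi : zmod_morphism (scalar_form^~ phi).
Proof. by move=> x y; rewrite /scalar_form linearBr innerBl. Qed.

Lemma scalar_formBr chi : zmod_morphism (scalar_form chi).
Proof. by move=> x y; rewrite /scalar_form linearBl innerBl. Qed.

Lemma scalar_formZl phi : scalable_for *%R (scalar_form^~ phi).
Proof. by move=> a x; rewrite /scalar_form linearZr_LR innerZl. Qed.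

Lemma scalar_formZr chi : scalable_for (Num.conj \; *%R) (scalar_form chi).
Proof. by move=> a x; rewrite /scalar_form linearZl_LR innerZl. Qed.

HB.instance Definition _ := isBilinear.Build _ _ _ _ _ _ scalar_form
  scalar_formBl scalar_formBr scalar_formZl scalar_formZr.

Lemma left_translateB x (phi chi : L) :
  left_translate x (phi - chi) = left_translate x phi - left_translate x chi.
Proof. exact/val_inj. Qed.

Lemma left_translateZ x a (phi : L) :
  left_translate x (a *: phi) = a *: left_translate x phi.
Proof. exact/val_inj. Qed.

(** The difference of the two sides is sesquilinear in (chi, phi), and for
chi = phi it vanishes: positive definiteness gives the conjugate symmetry in x,
and positivity of [scalar_form] the conjugate symmetry in the two arguments. *)
Lemma scalar_form_translate x chi phi :
  scalar_form chi (left_translate x^-1 phi) = scalar_form (left_translate x chi) phi.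
Proof.
pose d (chi phi : L) :=
  scalar_form chi (left_translate x^-1 phi) - scalar_form (left_translate x chi) phi.
have Dl w : zmod_morphism (d^~ w).
  move=> u u'; rewrite /d left_translateB !scalar_formBl; ring.
have Dr u : zmod_morphism (d u).
  move=> w w'; rewrite /d left_translateB !scalar_formBr; ring.
have Zl w : scalable_for *%R (d^~ w).
  by move=> a u; rewrite /d left_translateZ !scalar_formZl mulrBr.
have Zr u : scalable_for (Num.conj \; *%R) (d u).
  by move=> a w; rewrite /d left_translateZ !scalar_formZr/= mulrBr.
pose q : {bilinear L -> L -> C | *%R & Num.conj \; *%R} :=
  HB.pack d (isBilinear.Build _ _ _ _ _ _ d Dl Dr Zl Zr).
have d0 phi' : q phi' phi' = 0.
  rewrite /q/= /d /scalar_form (posdef_conj x v (form_pd phi')).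
  apply/eqP; rewrite subr_eq0; apply/eqP/esym.
  have b_ge0 w : 0 <= scalar_form w w by exact: form_ge0.
  exact: (psd_form_conj b_ge0 phi' (left_translate x phi')).
by apply/eqP; rewrite -subr_eq0; apply/eqP; exact: (form_eq0 d0 chi phi).
Qed.

Lemma norm_scalar_op (a : R) : `|a%:C *: (1 : bop H)| <= `|a|%:C.
Proof.
apply: op_norm_le => [|w]; first by rewrite ler0c.
by rewrite /= normrZ normc_def /= expr0n addr0 sqrtr_sqr.
Qed.

(** Stated as an opaque existence fact so that two values of [scalar_map] are
never compared by unfolding. *)
Fact scalar_map_subproof (u : G -> R) :
  {phi : L | bounded_real u -> forall y, phi y = (u y)%:C *: (1 : bop H)}.
Proof.
exists (insubd (0 : L) (fun y => (u y)%:C *: (1 : bop H))) => -[M uM] y.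
have -> // : insubd (0 : L) (fun y => (u y)%:C *: (1 : bop H)) =
  (fun y => (u y)%:C *: (1 : bop H)) :> (G -> bop H).
rewrite insubdK// inE; exists M => z _.
by apply: le_trans (norm_scalar_op _) _; rewrite lecR.
Qed.

Definition scalar_map (u : G -> R) : L := sval (scalar_map_subproof u).

Lemma scalar_mapE u y : bounded_real u ->
  scalar_map u y = (u y)%:C *: (1 : bop H).
Proof. by move=> bu; exact: (svalP (scalar_map_subproof u)). Qed.

Lemma linfty_ext (phi chi : L) : (forall y, phi y = chi y) -> phi = chi.
Proof. by move=> e; apply/val_inj/funext. Qed.

Lemma linfty_lincombE a (phi chi : L) y :
  (a *: phi + chi) y = a *: phi y + chi y.
Proof. by []. Qed.

Lemma scalar_map_lincomb a u w : bounded_real u -> bounded_real w ->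
  scalar_map (fun y => a * u y + w y) = a%:C *: scalar_map u + scalar_map w.
Proof.
move=> bu bw; apply: linfty_ext => y.
rewrite linfty_lincombE (scalar_mapE y bu) (scalar_mapE y bw).
rewrite (scalar_mapE y (bounded_real_lincomb a bu bw)).
by rewrite scalerA -scalerDl rmorphD rmorphM.
Qed.

Lemma scalar_map_shift x u : bounded_real u ->
  scalar_map (fun y => u (x * y)%g) = left_translate x^-1 (scalar_map u).
Proof.
move=> bu; apply: linfty_ext => y; rewrite (scalar_mapE y (bounded_real_shift x bu)).
change ((u (x * y)%g)%:C *: (1 : bop H) = scalar_map u (x^-1^-1 * y)%g).
by rewrite (scalar_mapE _ bu) invgK.
Qed.

Lemma scalar_map1 : scalar_map (fun=> 1) = linfty_cst G (1 : bop H).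
Proof.
apply: linfty_ext => y; rewrite (scalar_mapE y (bounded_real_cst G 1)).
by rewrite scale1r.
Qed.

Lemma norm_scalar_map u (M : R) : (forall y, `|u y| <= M) ->
  `|scalar_map u| <= M%:C.
Proof.
move=> uM; have M0 : 0 <= M by apply: le_trans (uM 1%g).
apply: linfty_norm_le => [|y]; first by rewrite ler0c.
have bu : bounded_real u by exists M.
rewrite (scalar_mapE y bu).
by apply: le_trans (norm_scalar_op _) _; rewrite lecR.
Qed.

End fixed_vector.
Hypothesis kappa_gt0 : 0 < kappa.
Hypothesis form11 : form (linfty_cst G (1 : bop H)) (linfty_cst G (1 : bop H)) <> 0.

(** The functional u |-> Re b(u 1, 1) satisfies the hypotheses of
[amenable_of_shift_invariant]: its bound comes from Cauchy-Schwarz and from the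
bound on the form, its invariance from [scalar_form_translate] because the
constant map 1 is its own translate. *)
Lemma form_amenable : amenable R G.
Proof.
have [v v11] : exists v,
    scalar_form v (linfty_cst G (1 : bop H)) (linfty_cst G (1 : bop H)) != 0.
  apply: contrapT => nov; apply: form11; apply: bop_quadratic_eq0 => v.
  by apply/eqP; apply: contrapT => /negP v0; apply: nov; exists v.
set one := linfty_cst G (1 : bop H) in v11.
pose b : {bilinear L -> L -> C | *%R & Num.conj \; *%R} := scalar_form v.
have b_ge0 w : 0 <= b w w by exact: form_ge0.
have /complex_realP[s sE] := ger0_real (b_ge0 one).
have s0 : 0 < s.
  have : 0 < b one one by rewrite lt_def v11 b_ge0.
  by rewrite sE ltr0c.
have /complex_realP[n nE] := normr_real v.
have /complex_realP[K KE] := normr_real one.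
have bK w (M : R) : 0 <= M -> `|w| <= M%:C -> b w w <= (kappa * n ^+ 2 * M ^+ 2)%:C.
  move=> M0 wM; rewrite -[leLHS]ger0_norm//.
  apply: le_trans (norm_inner _ _) _.
  apply: (@le_trans _ _ (`|form w w| * `|v| * `|v|)).
    by rewrite ler_wpM2r// op_norm_ub.
  have -> : (kappa * n ^+ 2 * M ^+ 2)%:C = kappa%:C * M%:C ^+ 2 * n%:C ^+ 2.
    by rewrite mulrAC 2!real_complexM !rmorphXn.
  rewrite -mulrA -expr2 nE ler_wpM2r//.
    by rewrite exprn_ge0// -nE.
  apply: le_trans (form_bounded _) _; rewrite ler_wpM2l//.
    by rewrite ler0c ltW.
  by rewrite ler_sqr ?nnegrE// ler0c.
pose rho u := complex.Re (b (scalar_map u) one).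
apply: (@amenable_of_shift_invariant R G rho).
- move=> a u w bu bw; rewrite /rho scalar_map_lincomb//.
  have -> : b (a%:C *: scalar_map u + scalar_map w) one =
      a%:C * b (scalar_map u) one + b (scalar_map w) one.
    by rewrite linearDl/= linearZl_LR.
  case: (b (scalar_map u) one) (b (scalar_map w) one) => [r r'] [t t'] /=; ring.
- exists (Num.sqrt (kappa * n ^+ 2 * s)) => u M uM.
  have M0 : 0 <= M by apply: le_trans (uM 1%g).
  have k0 : 0 <= kappa * n ^+ 2 * s.
    apply: mulr_ge0 (ltW s0); exact: mulr_ge0 (ltW kappa_gt0) (sqr_ge0 n).
  rewrite -ler_sqr ?nnegrE ?mulr_ge0 ?sqrtr_ge0// exprMn sqr_sqrtr//.
  rewrite -lecR rmorphXn/=.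
  apply: (@le_trans _ _ (`|b (scalar_map u) one| ^+ 2)).
    rewrite ler_sqr ?nnegrE ?normc_ge_Re//.
    by rewrite ler0c.
  apply: le_trans (psd_form_CauchySchwarz b_ge0 _ _) _.
  rewrite mulrAC real_complexM sE ler_wpM2r//.
    by rewrite ler0c ltW.
  by apply: bK => //; exact: norm_scalar_map.
- move=> x u bu; rewrite /rho scalar_map_shift//; congr complex.Re.
  transitivity (scalar_form v (scalar_map u) (left_translate (x^-1)^-1 one)).
    by apply/esym; apply: scalar_form_translate.
  by congr (scalar_form v _ _); exact: linfty_ext.
- by rewrite /rho scalar_map1 -/one sE.
Qed.

End form_amenable.

Theorem theorem1p3 (R : realType) (G : groupType) (H : hilbertType R)
    (H_neq0 : exists v : H, v != 0) :
  [<->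
   amenable R G ;
   exists (form : {bilinear linfty G (bop H) -> linfty G (bop H) -> bop H
                    | Num.conj \; *:%R & *:%R})
          (kappa : R),
     [/\ forall phi : linfty G (bop H), positive_op (form phi phi),
         0 < kappa,
         form (linfty_cst G (1 : bop H)) (linfty_cst G (1 : bop H)) <> 0,
         forall phi : linfty G (bop H), `|form phi phi| <= kappa%:C * `|phi| ^+ 2 &
         forall phi, positive_definite (fun x => form (left_translate x phi) phi)] ;
   exists tau : {scalar linfty G R[i]^o},
     is_state tau /\
     forall phi : linfty G (bop H), exists psi : G -> bop H,
       positive_definite psi /\
       forall (x : G) (Phi : {scalar bop H}), ultraweakly_continuous Phi ->
         Phi (adjoint (phi x) * psi x) =
         state_at tau
           (fun y => Phi (adjoint (phi x) * phi (x * y)%g * adjoint (phi y)))].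
Proof.
tfae.
- exact: amenable_form.
- move=> [form [kappa [form_ge0 kappa0 form11 form_bd form_pd]]].
  apply: amenable_correlation; exact: (form_amenable form_ge0 form_bd form_pd).
- move=> [tau [tau_state tau_cor]].
  exact: (correlation_amenable tau_state H_neq0 tau_cor).
Qed.
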